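(* Let $E$ be a symmetric space on $I$ (with the Fatou property). Assume that $x\in E$ is a point of lower $K$-monotonicity (an $LKM$ point) of $E$ with $x^*(\infty)=0$, and let $(x_n)\subset E$ be a sequence. If $x_n\prec x$ for all $n\in\mathbb{N}$ and $\|x_n\|_E\to\|x\|_E$, then $x_n^{**}\to x^{**}$ and $x_n^*\to x^*$ globally in measure.
   Context: Let $\mu$ be Lebesgue measure on $I=[0,\alpha)$, where $\alpha=1$ or $\alpha=\infty$, and let $L^0$ be the set of (equivalence classes of) extended real valued Lebesgue measurable functions on $I$. A Banach function space $E$ is a Banach lattice $(E,\|\cdot\|_E)$ which is a sublattice of $L^0$ such that: (1) if $x\in L^0$, $y\in E$ and $|x|\le|y|$ a.e., then $x\in E$ and $\|x\|_E\le\|y\|_E$; (2) there exists a strictly positive $x\in E$. $E^+=\{x\in E: x\ge 0\}$. $E$ has the Fatou property if whenever $(x_n)\subset E^+$, $\sup_n\|x_n\|_E<\infty$ and $x_n\uparrow x\in L^0$, then $x\in E$ and $\|x_n\|_E\uparrow\|x\|_E$. Standing assumption: $E$ has the Fatou property. For $x\in L^0$: the distribution function is $d_x(\lambda)=\mu\{s\in I:|x(s)|>\lambda\}$, $\lambda\ge0$; the decreasing rearrangement is $x^*(t)=\inf\{\lambda>0:d_x(\lambda)\le t\}$, $t\ge0$; the maximal function is $x^{**}(t)=\frac1t\int_0^t x^*(s)\,ds$, $t>0$. Convention: $x^*(\infty)=\lim_{t\to\infty}x^*(t)$ if $\alpha=\infty$, and $x^*(\infty)=0$ if $\alpha=1$.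 A Banach function space $E$ is symmetric if whenever $x\in L^0$, $y\in E$ and $d_x=d_y$, then $x\in E$ and $\|x\|_E=\|y\|_E$. For $x,y\in L^1+L^\infty$, the Hardy-Littlewood-Pólya relation is: $x\prec y$ iff $x^{**}(t)\le y^{**}(t)$ for all $t>0$. $x\in E$ is a point of lower $K$-monotonicity ($LKM$ point) of $E$ if for every $y\in E$ with $y^*\ne x^*$ and $y\prec x$ we have $\|y\|_E<\|x\|_E$. Functions $f_n$ converge to $f$ globally in measure if $\mu\{t\in I:|f_n(t)-f(t)|>\varepsilon\}\to0$ for every $\varepsilon>0$. *)

(* Defs.v *)
From HB Require Import structures.
From mathcomp Require Import all_boot all_order all_algebra.
From mathcomp Require Import all_classical all_reals all_analysis.
From mathcomp Require Import measurable_realfun.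

Set Implicit Arguments.
Unset Strict Implicit.
Unset Printing Implicit Defensive.

Import Order.TTheory GRing.Theory Num.Theory.
Import numFieldNormedType.Exports.

Local Open Scope classical_set_scope.
Local Open Scope ring_scope.

(* The real line equipped with the sigma-algebra of Lebesgue measurable sets,
   i.e. the domain of [completed_lebesgue_measure]. *)
Notation lebesgueTypeR R :=
  (caratheodory_type ((@wlength R idfun)^*)%mu).

Notation leb R := (@completed_lebesgue_measure R).

(* Functions on I = [0, a) are represented by total functions whose values
   outside I are irrelevant; [a] is meant to be 1 or +oo. *)
Definition dom (R : realType) (a : \bar R) : set R :=
  [set t | 0 <= t /\ (t%:E < a)%E].

(* Representatives of the elements of L^0; the identification of functions that
   are equal a.e. on I is made explicit wherever it is used. *)
Definition L0 (R : realType) (a : \bar R) (f : R -> \bar R) : Prop :=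
  measurable_fun (dom a : set (lebesgueTypeR R)) (f : lebesgueTypeR R -> \bar R).

Definition distr_fun (R : realType) (a : \bar R) (f : R -> \bar R) (l : R) :
    \bar R :=
  leb R [set s | dom a s /\ (l%:E < `|f s|)%E].

Definition rearr (R : realType) (a : \bar R) (f : R -> \bar R) (t : R) :
    \bar R :=
  ereal_inf [set l%:E | l in [set l : R | 0 < l /\ (distr_fun a f l <= t%:E)%E]].

Definition maxfun (R : realType) (a : \bar R) (f : R -> \bar R) (t : R) :
    \bar R :=
  (t^-1%:E *
   \int[leb R]_(s in (`[0%R, t]%classic : set (lebesgueTypeR R))) rearr a f s)%E.

Definition rearr_oo (R : realType) (a : \bar R) (f : R -> \bar R) : \bar R :=
  if a == +oo%E then lim (rearr a f t @[t --> +oo]) else 0%E.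

(* Every symmetric space is contained in L^1 + L^oo, so the two maximal functions
   are finite on (0, +oo) whenever f and g belong to such a space. *)
Definition hlp (R : realType) (a : \bar R) (f g : R -> \bar R) : Prop :=
  forall t : R, 0 < t -> (maxfun a f t <= maxfun a g t)%E.

Definition cvg_in_measure (R : realType) (a : \bar R)
    (f_ : nat -> R -> \bar R) (f : R -> \bar R) : Prop :=
  forall e : R, 0 < e ->
    leb R [set t | dom a t /\ (e%:E < `|f_ n t - f t|)%E]
      @[n --> \oo] --> 0%E.

(* A Banach function space is a real Banach space E whose elements are classes
   of functions: [ev x] is a representative of x.  By [bfs_inj] and [bfs_ideal],
   E is identified with a set of classes; "f belongs to E" reads
   "[ev x = f] a.e. on I for some x : E", and the order is the a.e. order.
   The axioms force [ev x] to be finite a.e. on I, so the junk values of the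
   operations of [\bar R] at infinities are immaterial. *)
Record is_banach_function_space (R : realType) (a : \bar R)
    (E : completeNormedModType R) (ev : E -> R -> \bar R) : Prop := {
  bfs_L0 : forall x : E, L0 a (ev x);
  bfs_inj : forall x y : E,
    {ae leb R, forall t, dom a t -> ev x t = ev y t} -> x = y;
  bfs_add : forall x y : E,
    {ae leb R, forall t, dom a t -> ev (x + y) t = (ev x t + ev y t)%E};
  bfs_scale : forall (c : R) (x : E),
    {ae leb R, forall t, dom a t -> ev (c *: x) t = (c%:E * ev x t)%E};
  bfs_max : forall x y : E, exists z : E,
    {ae leb R, forall t, dom a t -> ev z t = Order.max (ev x t) (ev y t)};
  bfs_min : forall x y : E, exists z : E,
    {ae leb R, forall t, dom a t -> ev z t = Order.min (ev x t) (ev y t)};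
  bfs_ideal : forall (f : R -> \bar R) (y : E), L0 a f ->
    {ae leb R, forall t, dom a t -> (`|f t| <= `|ev y t|)%E} ->
    exists x : E,
      {ae leb R, forall t, dom a t -> ev x t = f t} /\ `|x| <= `|y|;
  bfs_pos : exists x : E, {ae leb R, forall t, dom a t -> (0 < ev x t)%E}
}.

Definition fatou_property (R : realType) (a : \bar R)
    (E : completeNormedModType R) (ev : E -> R -> \bar R) : Prop :=
  forall (x_ : nat -> E) (f : R -> \bar R),
    (forall n, {ae leb R, forall t, dom a t -> (0 <= ev (x_ n) t)%E}) ->
    has_ubound (range (fun n => `|x_ n|)) ->
    L0 a f ->
    (forall n, {ae leb R, forall t, dom a t -> (ev (x_ n) t <= ev (x_ n.+1) t)%E}) ->
    {ae leb R, forall t, dom a t -> ev (x_ n) t @[n --> \oo] --> f t} ->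
    exists x : E,
      [/\ {ae leb R, forall t, dom a t -> ev x t = f t},
          nondecreasing_seq (fun n => `|x_ n|) &
          `|x_ n| @[n --> \oo] --> `|x|].

Definition symmetric_space (R : realType) (a : \bar R)
    (E : completeNormedModType R) (ev : E -> R -> \bar R) : Prop :=
  forall (f : R -> \bar R) (y : E), L0 a f ->
    (forall l : R, 0 <= l -> distr_fun a f l = distr_fun a (ev y) l) ->
    exists x : E,
      {ae leb R, forall t, dom a t -> ev x t = f t} /\ `|x| = `|y|.

Definition LKM_point (R : realType) (a : \bar R)
    (E : completeNormedModType R) (ev : E -> R -> \bar R) (x : E) : Prop :=
  forall y : E,
    ~ (forall t : R, 0 <= t -> rearr a (ev y) t = rearr a (ev x) t) ->
    hlp a (ev y) (ev x) -> `|y| < `|x|.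

(* Main.v *)
(* Write [X t] for the integral of the rearrangement x^* over [0, t]; then
   y < x means Y <= X.  Replacing x^* on an interval by a constant not exceeding
   its mean value does not increase the norm, since the result is dominated by
   averages of cyclic shifts of x^*.  On primitives this covers the operation
   X |-> min(X, l) for an affine l with positive slope.  Cutting X by tangent
   lines of a concave minorant Z on finer and finer grids and applying the Fatou
   property gives |z| <= |x| whenever z < x.

   Suppose X_n(t) <= X(t) - e for infinitely many n.  Since X_n is concave, it lies
   below one of finitely many lines l with l(t) < X(t), hence below min(X, l).
   The latter is the primitive of an element y < x with y^* <> x^*, and
   |x_n| <= |y| < |x| contradicts |x_n| -> |x|.  So X_n -> X pointwise, uniformly
   on compact sets, which gives both convergences in measure. *)

(* Norm monotonicity under [hlp] is not an axiom here and is derived from symmetry and the Fatou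
   property. [LKM_point] alone gives a strict inequality for each n with no gap uniform in n; a
   bound attached to a line is shared by all n whose primitive lies below it.

   A line of positive slope meets X again, since the rearrangement of x tends to 0, unless a is
   finite and the interval may end at a. Finitely many lines suffice because the slope of X_n at t
   is at most X(t)/t.

   An average of finitely many shifts is controlled by a Riemann sum that misses one cell, so
   flattening is first proved under a strict inequality and then rescaled.

   For the convergence in measure, X(t)/t bounds both kinds of functions at infinity, and a short
   interval next to 0 is discarded. *)
Require Import Defs.
From mathcomp Require Import all_boot all_order all_algebra.
From mathcomp Require Import all_classical all_reals all_analysis.
From mathcomp Require Import measurable_realfun lra ring.
Import Order.TTheory GRing.Theory Num.Theory.
Import numFieldNormedType.Exports.
Local Open Scope classical_set_scope.
Local Open Scope ring_scope.

(** * Lebesgue measure *)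

Section Lebesgue.
Context {R : realType}.
Implicit Types (A B : set R) (p q t : R).

(* [leb R] is an outer measure on all sets, so [le_leb] and [lebU] need no
   measurability. *)
Lemma leb_ext A : leb R A = ((@wlength R idfun)^*)%mu A.
Proof. by []. Qed.

Lemma le_leb A B : A `<=` B -> (leb R A <= leb R B)%E.
Proof. by move=> AB; rewrite !leb_ext; exact: le_mu_ext. Qed.

Lemma lebU A B : (leb R (A `|` B) <= leb R A + leb R B)%E.
Proof. by rewrite !leb_ext; exact: outer_measureU2. Qed.

Lemma leb_itv (i : interval R) :
  leb R [set` i] = (if i.1 < i.2 then (i.2 : \bar R) - i.1 else 0)%E.
Proof.
transitivity (@lebesgue_measure R [set` i]); first by rewrite leb_ext.
exact: lebesgue_measure_itv.
Qed.

Lemma measurable_leb_itv (i : interval R) :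
  measurable ([set` i] : set (lebesgueTypeR R)).
Proof. by apply: sub_caratheodory; exact: measurable_itv. Qed.

Lemma leb_itv_co p q : p <= q -> leb R `[p, q[ = (q - p)%:E.
Proof.
rewrite leb_itv /= lte_fin le_eqVlt => /predU1P[->|->//].
by rewrite ltxx subrr.
Qed.

Lemma leb_itv_cc p q : p <= q -> leb R `[p, q] = (q - p)%:E.
Proof.
rewrite leb_itv /= lte_fin le_eqVlt => /predU1P[->|->//].
by rewrite ltxx subrr.
Qed.

Definition below (c : \bar R) : set R := [set t | 0 <= t /\ (t%:E < c)%E].

Lemma belowE (c : \bar R) : (0 <= c)%E ->
  below c = [set` Interval (BLeft 0) (if c is r%:E%E then BLeft r else +oo%O)].
Proof.
case: c => [r| |] //= c0; apply/seteqP; split => t; rewrite /below /= in_itv /= ?lte_fin.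
- by move=> [-> ->].
- by move=> /andP.
- by move=> [-> _].
- by rewrite andbT => ->; split=> //; exact: ltry.
Qed.

Lemma measurable_below (c : \bar R) : (0 <= c)%E ->
  measurable (below c : set (lebesgueTypeR R)).
Proof. by move=> c0; rewrite belowE //; exact: measurable_leb_itv. Qed.

Lemma leb_below (c : \bar R) : (0 <= c)%E -> leb R (below c) = c.
Proof.
move=> c0; rewrite belowE // leb_itv /=; case: c c0 => [r| |] //=.
  by rewrite lee_fin lte_fin le_eqVlt => /predU1P[<-|->]; rewrite ?ltxx ?sube0.
by rewrite lt0y.
Qed.

Lemma domE (a : \bar R) : dom a = below a. Proof. by []. Qed.

(** For a negative level the superlevel set is the whole domain, so only levels [l >= 0] need
    checking. *)
Lemma L0_nonneg (a : \bar R) (f : R -> \bar R) :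
  (forall t, dom a t -> (0 <= f t)%E) ->
  (forall l, 0 <= l ->
    measurable ([set s | dom a s /\ (l%:E < f s)%E] : set (lebesgueTypeR R))) ->
  L0 a f.
Proof.
move=> f0 mf mD; apply: (measurability _ (ErealGenOInfty.measurableE R)) => //.
move=> _ [_ [l ->] <-].
have [l0|l0] := leP 0 l.
  have -> : dom a `&` f @^-1` `]l%:E, +oo[ = [set s | dom a s /\ (l%:E < f s)%E].
    by apply/seteqP; split => s /=; rewrite in_itv /= andbT.
  exact: mf.
have -> : dom a `&` f @^-1` `]l%:E, +oo[ = dom a.
  apply/seteqP; split => s /=; rewrite in_itv /= andbT; first by case.
  by move=> ds; split=> //; rewrite (lt_le_trans _ (f0 _ ds)) // lte_fin.
exact: mD.
Qed.

Lemma eq_ge0_ereal (y z : \bar R) : (0 <= y)%E -> (0 <= z)%E ->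
  (forall l : R, 0 <= l -> (l%:E < y)%E = (l%:E < z)%E) -> y = z.
Proof.
suff le (u v : \bar R) : (0 <= u)%E -> (0 <= v)%E ->
    (forall l : R, 0 <= l -> (l%:E < u)%E = (l%:E < v)%E) -> (u <= v)%E.
  move=> y0 z0 yz; apply/eqP; rewrite eq_le; apply/andP; split; apply: le => // l l0.
  by rewrite yz.
move=> u0 v0 uv; rewrite leNgt; apply/negP => vu.
case: v v0 uv vu => [r| |] //=; last by move=> _ _; rewrite ltNge leey.
by rewrite lee_fin => r0 /(_ _ r0) ->; rewrite ltxx.
Qed.

Lemma leb_ae_filter : Filter (almost_everywhere (leb R)).
Proof. exact: ae_filter_ringOfSetsType. Qed.

Lemma leb_aeS (P Q : set R) : P `<=` Q ->
  {ae leb R, forall t, P t} -> {ae leb R, forall t, Q t}.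
Proof. by move=> PQ; apply: (@filterS _ _ leb_ae_filter). Qed.

Lemma leb_aeI (P Q : set R) : {ae leb R, forall t, P t} ->
  {ae leb R, forall t, Q t} -> {ae leb R, forall t, P t /\ Q t}.
Proof. exact: (@filterI _ _ leb_ae_filter). Qed.

Lemma leb_aeW (P : set R) : (forall t, P t) -> {ae leb R, forall t, P t}.
Proof. by move=> PT; apply: (@filterS _ _ leb_ae_filter setT) filterT. Qed.

End Lebesgue.

(** * Decreasing rearrangements *)

(* [profile a f] says that f is nonnegative, nonincreasing and right-continuous
   on [0, oo) and vanishes on [a, oo), i.e. that f is its own rearrangement. *)
Definition profile {R : realType} (a : \bar R) (f : R -> \bar R) : Prop :=
  (forall t, 0 <= t -> (0 <= f t)%E) /\
  (forall l, 0 <= l -> exists c : \bar R, [/\ (0 <= c)%E, (c <= a)%E &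
     forall t, 0 <= t -> (l%:E < f t)%E = (t%:E < c)%E]).

Section Profiles.
Context {R : realType} {a : \bar R}.
Implicit Types (f g : R -> \bar R) (l m s t : R).

Lemma profile_superlevel f l : profile a f -> 0 <= l ->
  exists2 c : \bar R, (0 <= c)%E &
  [set s | dom a s /\ (l%:E < f s)%E] = below c /\
  forall t, 0 <= t -> (l%:E < f t)%E = (t%:E < c)%E.
Proof.
move=> [f0 fl] l0; have [c [c0 ca fc]] := fl l l0; exists c => //; split=> //.
apply/seteqP; split => s /=.
  by move=> [[s0 sa]]; rewrite fc.
by move=> [s0 sc]; split; [split=> //; exact: lt_le_trans ca|rewrite fc].
Qed.

(** The bound [c] supplied by [profile] has to be the distribution function, since [[0, c)] has
    measure [c]. *)
Lemma profile_distr f l t : profile a f -> 0 <= l -> 0 <= t ->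
  (l%:E < f t)%E = (t%:E < distr_fun a f l)%E.
Proof.
move=> pf l0 t0; have [c c0 [fE fc]] := profile_superlevel f l pf l0.
rewrite fc // /distr_fun.
have -> : [set s | dom a s /\ (l%:E < `|f s|)%E] = below c.
  rewrite -fE; apply/seteqP; split => s /= -[[s0 sa]].
    by rewrite gee0_abs //; exact: pf.1.
  by move=> lf; split=> //; rewrite gee0_abs //; exact: pf.1.
by rewrite leb_below.
Qed.

Lemma profile_L0 f : profile a f -> L0 a f.
Proof.
move=> pf; apply: L0_nonneg => [t [t0 _]|l l0]; first exact: pf.1.
have [c c0 [-> _]] := profile_superlevel f l pf l0.
exact: measurable_below.
Qed.

Lemma profile_nonincr f s t : profile a f -> 0 <= s -> s <= t -> (f t <= f s)%E.
Proof.
move=> pf s0 st; rewrite leNgt; apply/negP => fst.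
have fs0 := pf.1 s s0; have t0 := le_trans s0 st.
case fsE : (f s) fst fs0 => [r| |] // fst r0; last first.
  by move: fst; rewrite ltNge leey.
have [c [c0 ca fc]] := pf.2 r r0.
have : (r%:E < f s)%E.
  by rewrite fc // (@le_lt_trans _ _ t%:E) -?fc.
by rewrite fsE ltxx.
Qed.

Lemma profile_right_cont f l t : profile a f -> 0 <= t -> 0 <= l ->
  (l%:E < f t)%E -> exists2 h : R, 0 < h & forall s, 0 <= s -> s <= t + h ->
  (l%:E < f s)%E.
Proof.
move=> pf t0 l0; have [c [c0 ca fc]] := pf.2 l l0.
rewrite fc // => tc.
have [h h0 thc] : exists2 h : R, 0 < h & ((t + h)%:E < c)%E.
  case: c tc {c0 ca fc} => [r| |] //; last first.
    by move=> _; exists 1 => //; exact: ltry.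
  rewrite lte_fin => tr; exists ((r - t) / 2); first by rewrite divr_gt0 ?subr_gt0.
  by rewrite lte_fin; lra.
by exists h => // s s0 sth; rewrite fc // (le_lt_trans _ thc) // lee_fin.
Qed.

Lemma profile_out f t : profile a f -> 0 <= t -> (a <= t%:E)%E -> f t = 0%E.
Proof.
move=> pf t0 at_; apply/eqP; rewrite eq_le pf.1 // andbT leNgt.
have [c [c0 ca ->]] := pf.2 0 (lexx _) => //.
by rewrite -leNgt (le_trans ca).
Qed.

Lemma distr_le f l : (0 <= a)%E -> (distr_fun a f l <= a)%E.
Proof.
by move=> a0; rewrite -[leRHS]leb_below // -domE; apply: le_leb => s [].
Qed.

Lemma distr_ge0 f l : (0 <= distr_fun a f l)%E.
Proof. by rewrite /distr_fun leb_ext; exact: outer_measure_ge0. Qed.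

Lemma measurable_distr f l : L0 a f -> (0 <= a)%E ->
  measurable ([set s | dom a s /\ (l%:E < `|f s|)%E] : set (lebesgueTypeR R)).
Proof.
move=> mf a0.
have mabs : measurable_fun (dom a : set (lebesgueTypeR R))
    (abse \o (f : lebesgueTypeR R -> \bar R)) by exact: measurableT_comp.
have := mabs (measurable_below a a0) _ (emeasurable_itv `]l%:E, +oo[).
congr (measurable _); apply/seteqP.
by split => s /=; rewrite in_itv /= andbT.
Qed.

(** Continuity of the measure from below: the sets [F n] of level [l + 1/(n+1)] increase to the set
    of level [l]. *)
Lemma distr_right_cont f l t : L0 a f -> (0 <= a)%E ->
  (t%:E < distr_fun a f l)%E ->
  exists2 m, l < m & (t%:E < distr_fun a f m)%E.
Proof.
move=> mf a0 tl.
pose F (n : nat) := [set s | dom a s /\ ((l + n.+1%:R^-1)%:E < `|f s|)%E].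
have UF : \bigcup_n F n = [set s | dom a s /\ (l%:E < `|f s|)%E].
  apply/seteqP; split => s /=.
    move=> [n _ [ds ls]]; split=> //; apply: le_lt_trans ls.
    by rewrite lee_fin lerDl invr_ge0.
  move=> [ds ls]; suff [n ln] : exists n : nat, ((l + n.+1%:R^-1)%:E < `|f s|)%E.
    by exists n.
  case: (`|f s|%E) ls => [r| |] //; last by move=> _; exists 0%N; exact: ltry.
  rewrite lte_fin => lr; have rl : 0 < r - l by rewrite subr_gt0.
  have [n _ /(_ n (leqnn n)) /= ln] := near_infty_natSinv_lt (PosNum rl).
  by exists n; rewrite lte_fin -ltrBrDl.
have cF : leb R (F n) @[n --> \oo] --> distr_fun a f l.
  rewrite /distr_fun -UF; apply: (@nondecreasing_cvg_mu _ (lebesgueTypeR R)).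
  - by move=> n; exact: measurable_distr.
  - by apply: bigcup_measurable => n _; exact: measurable_distr.
  - move=> m n mn; apply/subsetPset => s [ds ls]; split=> //.
    apply: le_lt_trans ls; rewrite lee_fin lerD2l lef_pV2 ?posrE //.
    by rewrite ler_nat ltnS.
have [n tn] : exists n, (t%:E < leb R (F n))%E.
  apply: contrapT => /forallNP tF; move: tl; apply/negP; rewrite -leNgt.
  rewrite -(cvg_lim _ cF) //; apply: lime_le; first by apply/cvg_ex; exists (distr_fun a f l).
  by apply: nearW => n; rewrite leNgt; exact/negP/tF.
by exists (l + n.+1%:R^-1) => //; rewrite ltrDl invr_gt0.
Qed.

Lemma le_distr f l m : l <= m -> (distr_fun a f m <= distr_fun a f l)%E.
Proof.
by move=> lm; apply: le_leb => s [ds ms]; split=> //; apply: le_lt_trans ms; rewrite lee_fin.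
Qed.

Lemma rearr_ge0 f t : (0 <= rearr a f t)%E.
Proof. by apply: le_ereal_inf_tmp => _ [l [l0 _] <-]; rewrite lee_fin ltW. Qed.

(** Duality of rearrangement and distribution function. The strict inequality on the left needs a
    level above [l] that still has the property, hence [distr_right_cont]. *)
Lemma rearr_gtE f l t : L0 a f -> (0 <= a)%E -> 0 <= l ->
  (l%:E < rearr a f t)%E = (t%:E < distr_fun a f l)%E.
Proof.
move=> mf a0 l0; apply/idP/idP => [lf|tl].
  rewrite ltNge; apply/negP => lt.
  (* [rearr] ranges over positive levels only, so [l = 0] is not itself admissible, but every
     [l + e] is. *)
  move: lf; apply/negP; rewrite -leNgt; apply/lee_addgt0Pr => e e0.
  apply: ereal_inf_lbound; exists (l + e) => //; split; first by rewrite ltr_wpDl.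
  by apply: le_trans lt; apply: le_distr; rewrite lerDl ltW.
have [m lm tm] := distr_right_cont f l t mf a0 tl.
apply: (@lt_le_trans _ _ m%:E); first by rewrite lte_fin.
apply: le_ereal_inf_tmp => _ [k [k0 kt] <-]; rewrite lee_fin leNgt.
apply/negP => km; move: kt; apply/negP; rewrite -ltNge.
by apply: lt_le_trans tm _; apply: le_distr; rewrite ltW.
Qed.

Lemma rearr_profile f : L0 a f -> (0 <= a)%E -> profile a (rearr a f).
Proof.
move=> mf a0; split => [t _|l l0]; first exact: rearr_ge0.
exists (distr_fun a f l); split=> //; last by move=> t t0; exact: rearr_gtE.
exact: distr_le.
Qed.

Lemma rearr_id f t : profile a f -> (0 <= a)%E -> 0 <= t -> rearr a f t = f t.
Proof.
move=> pf a0 t0; apply: eq_ge0_ereal => [||l l0]; first exact: rearr_ge0.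
  exact: pf.1.
have mf := profile_L0 f pf.
by rewrite (rearr_gtE f l t mf a0 l0) (profile_distr f l t pf l0 t0).
Qed.

Lemma distr_rearr f l : L0 a f -> (0 <= a)%E -> 0 <= l ->
  distr_fun a (rearr a f) l = distr_fun a f l.
Proof.
move=> mf a0 l0.
rewrite -[RHS]leb_below; last exact: distr_ge0.
congr (leb R _); apply/seteqP; split => s /=.
  by move=> [[s0 _]]; rewrite gee0_abs ?rearr_ge0 // rearr_gtE.
move=> [s0 sl]; rewrite gee0_abs ?rearr_ge0 // rearr_gtE //; split=> //.
by split=> //; apply: lt_le_trans sl _; exact: distr_le.
Qed.

(** Subadditivity of the outer measure suffices, so [f] and [g] may be non-measurable. *)
Lemma distr_ae f g l : (0 <= a)%E ->
  {ae leb R, forall t, dom a t -> f t = g t} -> distr_fun a f l = distr_fun a g l.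
Proof.
move=> a0.
suff le u v : {ae leb R, forall t, dom a t -> u t = v t} ->
    (distr_fun a u l <= distr_fun a v l)%E.
  move=> fg; apply/eqP; rewrite eq_le le //= le //.
  by apply: leb_aeS fg => t + dt => /(_ dt) ->.
move=> [N [mN N0 uvN]]; apply: (@le_trans _ _ (distr_fun a v l + leb R N)%E).
  apply: le_trans (lebU _ _); apply: le_leb => s [ds ls].
  have [us|us] := eqVneq (u s) (v s); first by left; split=> //; rewrite -us.
  by right; apply: uvN => /= /(_ ds); exact/eqP.
by rewrite N0 adde0.
Qed.

Lemma rearr_ae f g t : (0 <= a)%E ->
  {ae leb R, forall t, dom a t -> f t = g t} -> rearr a f t = rearr a g t.
Proof.
move=> a0 fg; congr (ereal_inf (image _ _)); apply/seteqP; split => l /= [l0];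
  by rewrite (distr_ae f g).
Qed.

End Profiles.

(** * Integrals over half-open intervals *)

Section Integrals.
Context {R : realType}.
Implicit Types (f g : R -> \bar R) (p q r s t c : R).

(** Half-open intervals concatenate without overlap; [integral_cc] translates the closed interval of
    [maxfun]. *)
Definition itg f p q : \bar R :=
  (\int[leb R]_(s in (`[p, q[%classic : set (lebesgueTypeR R))) f s)%E.

(** Measurability is required on the whole half-line, as the integrals in [maxfun] run past [a]. *)
Definition nonneg_L0 f := (forall t, 0 <= t -> (0 <= f t)%E) /\ L0 +oo%E f.

Lemma nonneg_L0_mfun f (A : set R) : nonneg_L0 f -> (forall t, A t -> 0 <= t) ->
  measurable_fun (A : set (lebesgueTypeR R)) (f : lebesgueTypeR R -> \bar R).
Proof.
move=> [_ mf] A0; apply: (@measurable_funS _ _ (lebesgueTypeR R) _ (dom +oo%E)) mf.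
  by rewrite domE; exact: measurable_below.
by move=> t /A0 t0; split=> //; exact: ltry.
Qed.

Lemma measurable_co p q : measurable (`[p, q[%classic : set (lebesgueTypeR R)).
Proof. exact: measurable_leb_itv. Qed.

Lemma itg_ge0 f p q : nonneg_L0 f -> 0 <= p -> (0 <= itg f p q)%E.
Proof.
move=> nf p0; apply: integral_ge0 => t /=; rewrite in_itv /= => /andP[pt _].
exact/nf.1/(le_trans p0).
Qed.

Lemma itg_cat f p q r : nonneg_L0 f -> 0 <= p -> p <= q -> q <= r ->
  itg f p r = (itg f p q + itg f q r)%E.
Proof.
move=> nf p0 pq qr; rewrite /itg.
have -> : `[p, r[%classic = `[p, q[ `|` `[q, r[ :> set R.
  apply/seteqP; split => t /=; rewrite !in_itv /=.
    by move=> /andP[pt tr]; case: (ltP t q) => tq; [left|right]; apply/andP.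
  by move=> [] /andP[h1 h2]; apply/andP; split=> //;
     [exact: lt_le_trans qr|exact: le_trans h1].
have U0 : forall t, (`[p, q[ `|` `[q, r[) t -> 0 <= t.
  by move=> t [] /=; rewrite in_itv /= => /andP[h _];
    [exact: le_trans h|exact: le_trans (le_trans p0 pq) h].
apply: ge0_integral_setU.
- exact: measurable_co.
- exact: measurable_co.
- exact: nonneg_L0_mfun.
- by move=> t /U0; exact: nf.1.
- apply/disj_setPLR => t /=; rewrite !in_itv /= => /andP[pt tq] /andP[qt _].
  by move: tq; rewrite ltNge qt.
Qed.

Lemma itg_cst p q c : p <= q -> itg (cst c%:E) p q = (c * (q - p))%:E.
Proof.
move=> pq; rewrite /itg integral_cst ?EFinM; last exact: measurable_co.
by congr (_ * _)%E; exact: leb_itv_co.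
Qed.

Lemma nonneg_L0_cst c : 0 <= c -> nonneg_L0 (cst c%:E).
Proof. by move=> c0; split => [t _|]; [rewrite lee_fin|exact: measurable_cst]. Qed.

Lemma le_itg f g p q : nonneg_L0 f -> nonneg_L0 g -> 0 <= p ->
  (forall t, p <= t -> t < q -> (f t <= g t)%E) -> (itg f p q <= itg g p q)%E.
Proof.
move=> nf ng p0 fg.
have D0 : forall t, `[p, q[%classic t -> 0 <= t.
  by move=> t /=; rewrite in_itv /= => /andP[h _]; exact: le_trans h.
apply: ge0_le_integral.
- exact: measurable_co.
- by move=> t /D0; exact: nf.1.
- exact: nonneg_L0_mfun.
- exact: nonneg_L0_mfun.
- by move=> t /=; rewrite in_itv /= => /andP[]; exact: fg.
Qed.

Lemma itg_ge_cst f p q c : nonneg_L0 f -> 0 <= c -> 0 <= p -> p <= q ->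
  (forall t, p <= t -> t < q -> (c%:E <= f t)%E) -> ((c * (q - p))%:E <= itg f p q)%E.
Proof.
by move=> nf c0 p0 pq cf; rewrite -itg_cst //; apply: le_itg => //; exact: nonneg_L0_cst.
Qed.

Lemma itg_le_cst f p q c : nonneg_L0 f -> 0 <= c -> 0 <= p -> p <= q ->
  (forall t, p <= t -> t < q -> (f t <= c%:E)%E) -> (itg f p q <= (c * (q - p))%:E)%E.
Proof.
by move=> nf c0 p0 pq cf; rewrite -itg_cst //; apply: le_itg => //; exact: nonneg_L0_cst.
Qed.

Lemma eq_itg f g p q : (forall t, p <= t -> t < q -> f t = g t) ->
  itg f p q = itg g p q.
Proof.
move=> fg; apply: eq_integral => t /=; rewrite inE /= in_itv /= => /andP[].
exact: fg.
Qed.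

Lemma itg_nil f p : itg f p p = 0%E.
Proof. by rewrite /itg set_itv_ge ?integral_set0 // bnd_simp ltxx. Qed.

Lemma leb_set1 t : leb R [set t] = 0%E.
Proof. by rewrite -set_itv1 leb_itv_cc // subrr. Qed.

Lemma measurable_set1_leb t : measurable ([set t] : set (lebesgueTypeR R)).
Proof. by rewrite -set_itv1; exact: measurable_leb_itv. Qed.

Lemma integral_leb_D1 f (A : set R) t : nonneg_L0 f -> (forall t, A t -> 0 <= t) ->
  measurable (A : set (lebesgueTypeR R)) ->
  (\int[leb R]_(s in (A : set (lebesgueTypeR R))) f s =
   \int[leb R]_(s in ((A `\ t) : set (lebesgueTypeR R))) f s)%E.
Proof.
move=> nf A0 mA; apply: ge0_negligible_integral => //.
- exact: measurable_set1_leb.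
- exact: nonneg_L0_mfun.
- by move=> s /A0; exact: nf.1.
- exact: leb_set1.
Qed.

Lemma integral_cc f t : nonneg_L0 f ->
  (\int[leb R]_(s in (`[0%R, t]%classic : set (lebesgueTypeR R))) f s)%E = itg f 0 t.
Proof.
move=> nf; rewrite (integral_leb_D1 _ _ t nf); last 2 first.
- by move=> s /=; rewrite in_itv /= => /andP[].
- exact: measurable_leb_itv.
by rewrite setDitv1r.
Qed.

(** Monotone convergence along [[p + 1/(n+1), q)], which exhausts the interval up to the null set
    [{p}]. The form with a lower bound [c] also covers an infinite integral, needed before
    finiteness is known. *)
Lemma itg_cont f p q c : nonneg_L0 f -> 0 <= p -> (c%:E < itg f p q)%E ->
  exists2 d, 0 < d & forall h, 0 <= h -> h <= d -> (c%:E < itg f (p + h) q)%E.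
Proof.
move=> nf p0 cf.
pose F (n : nat) : set R := `[p + n.+1%:R^-1, q[%classic.
have UF : \bigcup_n F n = `[p, q[ `\ p.
  apply/seteqP; split => s /=.
    move=> [n _]; rewrite /F /= !in_itv /= => /andP[ps ->]; rewrite andbT.
    have n0 : 0 < n.+1%:R^-1 :> R by rewrite invr_gt0.
    by move: _^-1 n0 ps => e n0 ps; split; [lra|apply/eqP; rewrite gt_eqF //; lra].
  rewrite in_itv /= => -[/andP[ps sq] /eqP sp].
  have : 0 < s - p by rewrite subr_gt0 lt_neqAle eq_sym sp.
  move=> sp0; have [n _ /(_ n (leqnn n)) /= ln] := near_infty_natSinv_lt (PosNum sp0).
  by exists n => //; rewrite /F /= in_itv /= sq andbT -lerBrDl ltW.
have F0 n t : F n t -> 0 <= t.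
  rewrite /F /= in_itv /= => /andP[pt _]; apply: le_trans pt.
  by rewrite addr_ge0 // invr_ge0.
have cF : itg f (p + n.+1%:R^-1) q @[n --> \oo] --> itg f p q.
  rewrite [itg f p q](integral_leb_D1 _ _ p nf); last 2 first.
  - by move=> s /=; rewrite in_itv /= => /andP[h _]; exact: le_trans h.
  - exact: measurable_co.
  rewrite -UF; apply: ge0_nondecreasing_set_cvg_integral.
  - move=> m n mn; apply/subsetPset => s; rewrite /F /= !in_itv /= => /andP[h ->].
    rewrite andbT; apply: le_trans h; rewrite lerD2l lef_pV2 ?posrE //.
    by rewrite ler_nat ltnS.
  - by move=> n; exact: measurable_co.
  - by move=> n; apply: nonneg_L0_mfun => // t /F0.
  - by move=> n t /F0; exact: nf.1.
have [n cn] : exists n : nat, (c%:E < itg f (p + n.+1%:R^-1) q)%E.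
  apply: contrapT => /forallNP tF; move: cf; apply/negP; rewrite -leNgt.
  rewrite -(cvg_lim _ cF) //; apply: lime_le; first by apply/cvg_ex; exists (itg f p q).
  by apply: nearW => n; rewrite leNgt; exact/negP/tF.
exists n.+1%:R^-1; first by rewrite invr_gt0.
move=> h h0 hn; apply: lt_le_trans cn _.
apply: ge0_subset_integral.
- exact: measurable_co.
- exact: measurable_co.
- apply: nonneg_L0_mfun => // t /=; rewrite in_itv /= => /andP[ht _].
  by apply: le_trans ht; rewrite addr_ge0.
- move=> t /=; rewrite in_itv /= => /andP[ht _].
  by apply: nf.1; apply: le_trans ht; rewrite addr_ge0.
- move=> t /=; rewrite !in_itv /= => /andP[ht ->]; rewrite andbT.
  by apply: le_trans ht; rewrite lerD2l.
Qed.

Lemma profile_nonneg_L0 {a : \bar R} {f} : profile a f -> nonneg_L0 f.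
Proof.
move=> pf; split; first exact: pf.1.
apply: profile_L0; split; first exact: pf.1.
by move=> l /(pf.2 l) [c [c0 ca fc]]; exists c; split=> //; exact: leey.
Qed.

Lemma maxfunE (a : \bar R) f t : L0 a f -> (0 <= a)%E ->
  maxfun a f t = (t^-1%:E * itg (rearr a f) 0 t)%E.
Proof.
move=> mf a0; rewrite /maxfun integral_cc //.
exact: profile_nonneg_L0 (rearr_profile f mf a0).
Qed.

End Integrals.

(** * Cyclic shifts of an interval *)

Section Shift.
Context {R : realType} {a : \bar R}.
Variables p q : R.
Hypotheses (p0 : 0 <= p) (pq : p < q) (qa : (q%:E <= a)%E).
Implicit Types (u : R -> \bar R) (c : \bar R) (d h l s t : R).

(** Rotation of [[p, q)] by [d], fixing all other points. Composing with it preserves the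
    distribution function, and thus the norm in a symmetric space. *)
Definition cyc d t : R :=
  if (p <= t) && (t < q) then (if t + d < q then t + d else t + d - (q - p)) else t.

Lemma cyc_ge0 d t : 0 <= d -> 0 <= t -> 0 <= cyc d t.
Proof.
have p0' := p0; have pq' := pq.
move=> d0 t0; rewrite /cyc; case: ifPn => // /andP[pt tq].
by case: (ltP (t + d) q) => /= h; lra.
Qed.

(** Initial segments are enough because superlevel sets of profiles have this form. The rotation can
    change the segment only for [p < c < q], and then the preimage is an initial segment plus one
    block starting at [q - d]. *)
Lemma leb_cyc d c : 0 <= d -> d < q - p -> (0 <= c)%E -> (c <= a)%E ->
  let S := [set s | dom a s /\ ((cyc d s)%:E < c)%E] in
  measurable (S : set (lebesgueTypeR R)) /\ leb R S = c.
Proof.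
have p0' := p0; have pq' := pq.
move=> d0 dqp c0 ca S.
suff [SE|[r [cE [m [n [m0 n0 mn SE]]]]]] : S = below c \/ exists r, c = r%:E /\
    exists m n : R, [/\ 0 <= m, m <= n, 0 <= m + (r - m) /\ n + (r - m) >= n &
      S = `[0, m[ `|` `[n, n + (r - m)[].
- by rewrite SE; split; [exact: measurable_below|exact: leb_below].
- rewrite SE; have mA : measurable (`[0, m[%classic : set (lebesgueTypeR R)).
    exact: measurable_leb_itv.
  have mB : measurable (`[n, n + (r - m)[%classic : set (lebesgueTypeR R)).
    exact: measurable_leb_itv.
  split; first exact: measurableU.
  transitivity (leb R `[0%R, m[%classic + leb R `[n, (n + (r - m))%R[%classic)%E.
    apply: (@measureU _ (lebesgueTypeR R) _ (leb R)) => //; apply/eqP.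
    apply/eqP/seteqP; split=> // s [] /=; rewrite !in_itv /= => /andP[_ h1] /andP[h2 _].
    by move: h1; rewrite ltNge (le_trans n0).
  rewrite !leb_itv_co // ?cE -?EFinD; [congr EFin; lra|lra].
have domT s : 0 <= s -> s < q -> dom a s.
  by move=> s0 sq; split=> //; apply: lt_le_trans qa; rewrite lte_fin.
have [qc|cq] := leP q%:E c.
  left; apply/seteqP; split => s; rewrite /S /below /=.
    move=> [[s0 sa] sc]; split=> //; case: (ltP s q) => sq; last first.
      by move: sc; rewrite /cyc (ltNge s q) sq andbF.
    by apply: lt_le_trans qc; rewrite lte_fin.
  move=> [s0 sc]; split; first by split=> //; exact: lt_le_trans ca.
  rewrite /cyc; case: ifPn => // /andP[ps sq]; apply: lt_le_trans qc.
  by rewrite lte_fin; case: (ltP (s + d) q) => /= h; lra.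
have [cp|pc] := leP c p%:E.
  left; apply/seteqP; split => s; rewrite /S /below /=.
    move=> [[s0 sa]]; rewrite /cyc; case: ifPn => [/andP[ps sq] h|_ //].
    exfalso; move: (lt_le_trans h cp); rewrite lte_fin; case: (ltP (s + d) q) => /= h'; lra.
  move=> [s0 sc]; split; first by split=> //; exact: lt_le_trans ca.
  have := lt_le_trans sc cp; rewrite lte_fin => sp.
  by rewrite /cyc leNgt sp.
right; case: c c0 ca cq pc @S => [r| |] //= r0 ra; rewrite !lte_fin => rq pr; set S := [set s | _].
exists r; split=> //.
have Sin s : S s <-> 0 <= s /\ cyc d s < r.
  split => [[[s0 sa] h]|[s0 h]]; first by [].
  split=> //; apply: domT => //.
  by move: h; rewrite /cyc; case: ifPn => [/andP[]//|_ h]; exact: lt_trans rq.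
(* The wrapped block [[q - d, q)] is carried onto [[p, p + d)]; the cases say whether [r] is reached
   within that image. *)
have [rpd|pdr] := leP r (p + d).
  exists p, (q - d); split=> //; [lra|lra|].
  apply/seteqP; split => s; rewrite Sin /= !in_itv /=.
    move=> [s0]; rewrite /cyc; case: (leP p s) => ps /=; last first.
      by left; rewrite s0.
    by case: (ltP s q) => sq; [case: (ltP (s + d) q) => /= h h'; right; apply/andP; split; lra|lra].
  move=> [/andP[s0 sp]|/andP[h1 h2]].
    by split=> //; rewrite /cyc leNgt sp /=; lra.
  split; first by lra.
  rewrite /cyc; case: ifPn => [_|]; first by case: (ltP (s + d) q) => /= h; lra.
  by rewrite negb_and -!ltNge -leNgt => /orP[]; lra.
exists (r - d), (q - d); split; [lra|lra|lra|].
apply/seteqP; split => s; rewrite Sin /= !in_itv /=.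
  move=> [s0]; rewrite /cyc; case: (leP p s) => ps /=; last first.
    by left; rewrite s0 /=; lra.
  case: (ltP s q) => sq; last by lra.
  by case: (ltP (s + d) q) => /= h h'; [left|right]; apply/andP; split; lra.
move=> [/andP[s0 sp]|/andP[h1 h2]].
  split=> //; rewrite /cyc; case: ifPn => [/andP[ps sq]|].
    by case: (ltP (s + d) q) => /= h; lra.
  by rewrite negb_and -!ltNge -leNgt => /orP[]; lra.
split; first by lra.
rewrite /cyc; case: ifPn => [_|]; first by case: (ltP (s + d) q) => /= h; lra.
by rewrite negb_and -!ltNge -leNgt => /orP[]; lra.
Qed.

Lemma cyc_superlevel u d l : profile a u -> 0 <= d -> 0 <= l ->
  exists c : \bar R, [/\ (0 <= c)%E, (c <= a)%E, distr_fun a u l = c &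
  [set s | dom a s /\ (l%:E < u (cyc d s))%E] =
  [set s | dom a s /\ ((cyc d s)%:E < c)%E]].
Proof.
move=> pu d0 l0; exists (distr_fun a u l).
have [c [c0 ca uc]] := pu.2 l l0.
split=> //; first by apply: distr_le; exact: le_trans ca.
have E s (s0 : 0 <= s) := profile_distr u l (cyc d s) pu l0 (cyc_ge0 d s d0 s0).
by apply/seteqP; split => s [[s0 sa]] h; split; rewrite ?E // -?E.
Qed.

Lemma cyc_L0 u d : profile a u -> 0 <= d -> d < q - p -> L0 a (u \o cyc d).
Proof.
move=> pu d0 dqp; apply: L0_nonneg => [s [s0 _]|l l0].
  exact/pu.1/cyc_ge0.
have [c [c0 ca _ /= ->]] := cyc_superlevel u d l pu d0 l0.
exact: (leb_cyc d c d0 dqp c0 ca).1.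
Qed.

Lemma cyc_distr u d l : profile a u -> 0 <= d -> d < q - p -> 0 <= l ->
  distr_fun a (u \o cyc d) l = distr_fun a u l.
Proof.
move=> pu d0 dqp l0; have [c [c0 ca uc E]] := cyc_superlevel u d l pu d0 l0.
rewrite uc -[RHS](leb_cyc d c d0 dqp c0 ca).2 -E; congr (leb R _).
by apply/seteqP; split => s [[s0 sa]]; rewrite /= gee0_abs //; exact/pu.1/cyc_ge0.
Qed.

(** Riemann sum at left endpoints. Infinite values are allowed, because finiteness of the integral
    is itself deduced from these estimates in [itg_fin]. *)
Lemma itg_le_sum u s h k : profile a u -> 0 <= s -> 0 < h ->
  (itg u s (s + k%:R * h)%R <= h%:E * \sum_(0 <= j < k) u (s + j%:R * h)%R)%E.
Proof.
move=> pu s0 h0; have nu := profile_nonneg_L0 pu.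
elim: k => [|k IH].
  by rewrite big_geq // mul0r addr0 itg_nil mule0.
have kh : 0 <= k%:R * h by rewrite mulr_ge0 // ltW.
rewrite big_nat_recr //= ge0_muleDr; last 2 first.
- by apply: sume_ge0 => j _; apply: pu.1; rewrite addr_ge0 // mulr_ge0 // ltW.
- by apply: pu.1; rewrite addr_ge0.
have skh : 0 <= s + k%:R * h by rewrite addr_ge0.
rewrite (itg_cat _ _ (s + k%:R * h)) //; last 2 first.
- by rewrite lerDl.
- by rewrite lerD2l ler_wpM2r ?ler_nat // ltW.
apply: leeD => //.
have [uoo|uoo] := eqVneq (u (s + k%:R * h)) +oo%E.
  by rewrite uoo gt0_muley ?lte_fin // leey.
have fu : u (s + k%:R * h) \is a fin_num by rewrite ge0_fin_numE ?pu.1 // lt_neqAle uoo leey.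
rewrite -(fineK fu) -EFinM.
have -> : h * fine (u (s + k%:R * h)) =
    fine (u (s + k%:R * h)) * (s + k.+1%:R * h - (s + k%:R * h)).
  by rewrite -natr1; ring.
apply: itg_le_cst => //; first by rewrite fine_ge0 ?pu.1.
- by rewrite lerD2l ler_wpM2r ?ler_nat // ltW.
- move=> t st _; rewrite fineK //; exact: profile_nonincr pu skh st.
Qed.

(* Summed over the whole cycle, the cyclic shifts of [u] by multiples of
   [h = (q - p) / N] bound [u] from above by an integral over all but the
   first cell of [p, q). *)
Lemma sum_cyc_ge u (N : nat) h t : profile a u -> 0 < h -> N%:R * h = q - p ->
  p <= t -> t < q ->
  (itg u (p + h) q <= h%:E * \sum_(0 <= j < N) (u \o cyc (j%:R * h)%R) t)%E.
Proof.
have p0' := p0; have pq' := pq.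
move=> pu h0 Nh pt tq; have nu := profile_nonneg_L0 pu.
(* The first [m] shifts of [t] do not wrap and sample [u] on [[t, q)]. *)
have exm : exists m : nat, q <= t + m%:R * h by exists N; lra.
set m := ex_minn exm.
have [qm mmin] : q <= t + m%:R * h /\
    forall j : nat, (j < m)%N -> t + j%:R * h < q.
  rewrite /m; case: ex_minnP => k qk kmin; split=> // j jk.
  by rewrite ltNge; apply/negP => /kmin; rewrite leqNgt jk.
have mN : (m <= N)%N.
  by rewrite leqNgt; apply/negP => /mmin; rewrite Nh; lra.
have m0 : (0 < m)%N.
  by rewrite lt0n; apply/eqP => m0; move: qm; rewrite m0; lra.
have mh : t + m%:R * h < q + h.
  have := mmin m.-1; rewrite prednK // leqnn => /(_ isT).
  by rewrite -{2}(prednK m0) -natr1; lra.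
rewrite (big_cat_nat _ (n := m)) //= ge0_muleDr; last 2 first.
- by apply: sume_ge0 => j _; apply/pu.1/cyc_ge0; [rewrite mulr_ge0 // ltW|lra].
- by apply: sume_ge0 => j _; apply/pu.1/cyc_ge0; [rewrite mulr_ge0 // ltW|lra].
have t0 : 0 <= t by lra.
have first : (itg u t q <= h%:E * \sum_(0 <= j < m) u (cyc (j%:R * h)%R t))%E.
  rewrite (@eq_big_nat _ _ _ _ _ _ (fun j => u (t + j%:R * h))); last first.
    by move=> j /andP[_ jm]; rewrite /cyc pt tq /= mmin.
  apply: le_trans (itg_le_sum u t h m pu t0 h0).
  rewrite [leRHS](itg_cat _ _ q) //; [|exact: ltW].
  by rewrite leeDl // itg_ge0 //; lra.
(* The wrapped shifts sample [u] from [s] up to [t]. By the choice of [m], [p <= s < p + h], so all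
   samples together cover [[p + h, q)]. *)
pose s := t + m%:R * h - (q - p).
have second : (itg u s t <= h%:E * \sum_(m <= j < N) u (cyc (j%:R * h)%R t))%E.
  rewrite -{1}(subnK mN) -[X in (\sum_(X <= _ < _) _)%E]add0n big_addn addnK.
  rewrite (@eq_big_nat _ _ _ _ _ _ (fun j => u (s + j%:R * h))); last first.
    move=> j /andP[_ jm]; rewrite /cyc pt tq /= ltNge natrD mulrDl.
    have jh : 0 <= j%:R * h by rewrite mulr_ge0 // ltW.
    have -> /= : q <= t + (j%:R * h + m%:R * h) by lra.
    by congr u; rewrite /s; lra.
  have {1}-> : t = s + (N - m)%:R * h by rewrite natrB // mulrBl /s; lra.
  by apply: itg_le_sum => //; rewrite /s; lra.
rewrite addeC; apply: le_trans (leeD second first).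
have st : s <= t.
  have : m%:R * h <= N%:R * h by rewrite ler_wpM2r ?ler_nat // ltW.
  by rewrite /s; lra.
rewrite -itg_cat //; [|rewrite /s; lra|lra].
have [hq|hq] := leP (p + h) q; last first.
  rewrite {1}/itg set_itv_ge ?integral_set0; first by apply: itg_ge0 => //; rewrite /s; lra.
  by rewrite bnd_simp -leNgt ltW.
rewrite [leRHS](itg_cat _ _ (p + h)) //; [|rewrite /s; lra|rewrite /s; lra].
by rewrite leeDr // itg_ge0 //; rewrite /s; lra.
Qed.

End Shift.

(** * Primitives of rearrangements *)

Definition prim {R : realType} (f : R -> \bar R) (t : R) : R := fine (itg f 0 t).

(** A profile may be [+oo] at 0, where [fine] returns 0; comparisons with [f] therefore ask for a
    positive argument. *)
Definition fval {R : realType} (f : R -> \bar R) (t : R) : R := fine (f t).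

Definition vanishing {R : realType} (f : R -> \bar R) : Prop :=
  forall e : R, 0 < e -> exists2 T : R, 0 <= T & (f T <= e%:E)%E.

Section Primitive.
Context {R : realType} {a : \bar R} {f : R -> \bar R}.
Hypothesis pf : profile a f.
Hypothesis fin : forall q : R, 0 <= q -> (itg f 0 q < +oo)%E.
Implicit Types (p q s t u e : R).

Local Notation F := (prim f).
Local Notation f' := (fval f).

Let nf := profile_nonneg_L0 pf.

Lemma prim0 : F 0 = 0.
Proof. by rewrite /prim itg_nil. Qed.

Lemma primE t : 0 <= t -> (F t)%:E = itg f 0 t.
Proof. by move=> t0; rewrite fineK // ge0_fin_numE ?fin // itg_ge0. Qed.

Lemma itg_prim p q : 0 <= p -> p <= q -> itg f p q = (F q - F p)%:E.
Proof.
move=> p0 pq; have q0 := le_trans p0 pq.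
have := itg_cat f 0 p q nf (lexx 0) p0 pq.
rewrite -!primE // EFinB => ->.
by rewrite addeAC subee ?add0e.
Qed.

Lemma le_prim p q : 0 <= p -> p <= q -> F p <= F q.
Proof.
by move=> p0 pq; rewrite -subr_ge0 -lee_fin -itg_prim // itg_ge0.
Qed.

Lemma prim_ge0 t : 0 <= t -> 0 <= F t.
Proof. by move=> t0; rewrite -prim0; exact: le_prim. Qed.

Lemma prim_le0 t : t <= 0 -> F t = 0.
Proof.
by move=> t0; rewrite /prim /itg set_itv_ge ?integral_set0 // bnd_simp -leNgt.
Qed.

Lemma profile_fin_num t : 0 < t -> f t \is a fin_num.
Proof.
move=> t0; rewrite ge0_fin_numE; last by apply: pf.1; exact: ltW.
rewrite ltey; apply/eqP => foo.
have : ((((F t + 1) / t) * (t - 0))%:E <= itg f 0 t)%E.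
  apply: itg_ge_cst => //; [|exact: ltW|].
    by rewrite divr_ge0 ?ltW // ltr_wpDl // prim_ge0 // ltW.
  move=> u u0 ut; apply: (@le_trans _ _ (f t)); first by rewrite foo leey.
  exact: profile_nonincr pf u0 (ltW ut).
rewrite -primE ?(ltW t0) // lee_fin subr0 divfK ?gt_eqF //.
by rewrite leNgt ltrDl ltr01.
Qed.

Lemma fvalE t : 0 < t -> (f' t)%:E = f t.
Proof. by move=> t0; rewrite fineK // profile_fin_num. Qed.

Lemma fval_ge0 t : 0 <= t -> 0 <= f' t.
Proof. by move=> t0; rewrite fine_ge0 // pf.1. Qed.

Lemma fval_nonincr s t : 0 < s -> s <= t -> f' t <= f' s.
Proof.
move=> s0 st; rewrite -lee_fin !fvalE //; last exact: lt_le_trans st.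
exact: profile_nonincr pf (ltW s0) st.
Qed.

(** The integrand is at least [f s] before [s] and at most [f s] after it. The concavity facts below
    and the tangent lines come from this inequality. *)
Lemma prim_supergradient s t : 0 < s -> 0 <= t ->
  F t <= F s + (t - s) * f' s.
Proof.
move=> s0 t0; have [st|ts] := leP s t.
  rewrite -lerBlDl -lee_fin -itg_prim ?(ltW s0) // mulrC.
  apply: itg_le_cst => //; rewrite ?fval_ge0 ?(ltW s0) //.
  move=> u su _; rewrite fvalE //.
  exact: profile_nonincr pf (ltW s0) su.
have : ((f' s * (s - t))%:E <= itg f t s)%E.
  apply: itg_ge_cst => //; rewrite ?fval_ge0 ?(ltW s0) ?(ltW ts) //.
  move=> u tu us; rewrite fvalE //.
  by apply: profile_nonincr pf _ (ltW us); exact: le_trans tu.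
rewrite itg_prim ?(ltW ts) // lee_fin; nra.
Qed.

Lemma mul_fval_le_prim t : 0 < t -> t * f' t <= F t.
Proof.
move=> t0; have := prim_supergradient t 0 t0 (lexx 0).
by rewrite prim0 sub0r mulNr subr_ge0.
Qed.

Lemma prim_concave s t u : 0 <= s -> s <= t -> t <= u ->
  (u - t) * F s + (t - s) * F u <= (u - s) * F t.
Proof.
move=> s0 st tu; have [->|ts] := eqVneq t s.
  by rewrite subrr mul0r addr0.
have {ts} st' : s < t by rewrite lt_neqAle eq_sym ts.
have t0 : 0 < t by lra.
have h1 := prim_supergradient t s t0 s0.
have h2 := prim_supergradient t u t0 (le_trans (ltW t0) tu).
have ut : 0 <= u - t by lra.
have ts : 0 <= t - s by lra.
have := lerD (ler_wpM2l ut h1) (ler_wpM2l ts h2).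
move: (f' t) (F s) (F t) (F u) => v x y z; nra.
Qed.

(** A concave function vanishing at 0 is subadditive: add the chord inequalities at [s] and
    [t - s]. *)
Lemma prim_subadd s t : 0 <= s -> s <= t -> F t - F s <= F (t - s).
Proof.
move=> s0 st; have [->|s1] := eqVneq s 0; first by rewrite prim0 !subr0.
have {}s0 : 0 < s by rewrite lt_neqAle eq_sym s1.
have [->|ts] := eqVneq s t; first by rewrite !subrr prim0.
have {}st : s < t by rewrite lt_neqAle ts.
have h1 := prim_concave 0 (t - s) t (lexx 0) ltac:(lra) ltac:(lra).
have h2 := prim_concave 0 s t (lexx 0) ltac:(lra) ltac:(lra).
move: h1 h2; rewrite prim0 !mulr0 !add0r !subr0 => h1 h2.
have t0 : 0 < t by lra.
rewrite lerBlDl -(ler_pM2l t0) mulrDr.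
have := lerD h1 h2; move: (F t) => x; lra.
Qed.

Lemma prim_cont0 e : 0 < e -> exists2 d, 0 < d & F d <= e.
Proof.
move=> e0.
have : ((F 1 - e)%:E < itg f 0 1)%E.
  by rewrite -primE // lte_fin; move: (F 1) => x; lra.
move=> /(itg_cont f _ _ _ nf (lexx 0)) [d d0 h].
have [d1|d1] := leP d 1.
  exists d => //; have := h d (ltW d0) (lexx d).
  rewrite add0r itg_prim ?(ltW d0) // lte_fin.
  by move: (F 1) (F d) => x y; lra.
exists 1 => //; have := h 1 ler01 (ltW d1).
rewrite add0r itg_nil lte_fin.
by move: (F 1) => x; lra.
Qed.

(** So [F] is its own modulus of continuity. Negative arguments are included because
    [continuous_crossing] asks for continuity on the whole line. *)
Lemma prim_dist s t : `|F s - F t| <= F `|s - t|.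
Proof.
wlog st : s t / s <= t.
  by move=> H; have [st|/ltW ts] := leP s t; [exact: H|rewrite distrC (distrC s); exact: H].
have ts0 : `|t - s| = t - s by rewrite ger0_norm // subr_ge0.
rewrite distrC (distrC s) ts0.
have [s0|s0] := leP 0 s.
  by rewrite ger0_norm ?subr_ge0 ?le_prim // prim_subadd.
rewrite (prim_le0 s) ?(ltW s0) // subr0.
have [t0|t0] := leP 0 t; last first.
  by rewrite (prim_le0 t) ?(ltW t0) // normr0 prim_ge0 // subr_ge0.
by rewrite ger0_norm ?prim_ge0 //; apply: le_prim => //; lra.
Qed.

Lemma prim_modulus e : 0 < e ->
  exists2 d, 0 < d & forall s t, `|s - t| <= d -> `|F s - F t| <= e.
Proof.
move=> e0; have [d d0 de] := prim_cont0 e e0; exists d => // s t std.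
apply: le_trans (prim_dist s t) _; apply: le_trans de.
exact: le_prim.
Qed.

Lemma prim_continuous : continuous F.
Proof.
move=> t; apply/cvgrPdist_le => e e0.
have [d d0 h] := prim_modulus e e0.
near=> s; apply: h; near: s.
exact: cvgr_dist_le.
Unshelve. all: by end_near. Qed.

Lemma prim_out s t : 0 <= s -> (a <= s%:E)%E -> s <= t -> F t = F s.
Proof.
move=> s0 as_ st; apply/eqP; rewrite -subr_eq0 -eqe -itg_prim //.
rewrite (@eq_itg _ f (cst 0%E) s t) ?itg_cst ?mul0r //.
move=> u su _; apply: (profile_out _ _ pf); first exact: le_trans su.
by apply: le_trans as_ _; rewrite lee_fin.
Qed.

End Primitive.

Lemma continuous_crossing (R : realType) (g : R -> R) (p q : R) : continuous g ->
  p <= q -> (g p <= 0 /\ 0 <= g q) \/ (0 <= g p /\ g q <= 0) ->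
  exists c, [/\ p <= c, c <= q & g c = 0].
Proof.
move=> gc pq sgn; have [c] : exists2 c, c \in `[p, q] & g c = 0.
  apply: IVT => //; first exact: continuous_subspaceT.
  by case: sgn => -[h1 h2]; rewrite ge_min le_max h1 h2 ?orbT.
by rewrite in_itv /= => /andP[pc cq] gc0; exists c.
Qed.

(** * Norm estimates in symmetric spaces *)

Section Space.
Context {R : realType} {a : \bar R}.
Context {E : completeNormedModType R} {ev : E -> R -> \bar R}.
Hypotheses (a0 : (0 < a)%E) (hE : is_banach_function_space a ev).
Hypothesis hF : fatou_property a ev.
Hypothesis hS : symmetric_space a ev.
Implicit Types (f g : R -> \bar R) (b c d e h p q r s t T : R).

Definition represents f (x : E) := {ae leb R, forall t, dom a t -> ev x t = f t}.

(** Membership in E and a norm bound in one predicate on functions, so that domination,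
    rearrangement and averaging apply to formulas without naming elements. *)
Definition norm_le f r := exists2 x, represents f x & `|x| <= r.

Lemma norm_leP f (x : E) r : represents f x -> norm_le f r -> `|x| <= r.
Proof.
move=> fx [y fy yr]; suff -> : x = y by [].
apply: (bfs_inj hE); apply: (leb_aeS _ _ _ (leb_aeI _ _ fx fy)).
by move=> t [h1 h2] dt; rewrite h1 // h2.
Qed.

Lemma norm_le_ideal f g r : norm_le g r -> L0 a f ->
  (forall t, dom a t -> (`|f t| <= `|g t|)%E) -> norm_le f r.
Proof.
move=> [y gy yr] mf fg; have [|x [fx xy]] := bfs_ideal hE mf (y := y).
  by apply: (leb_aeS _ _ _ gy) => t gt dt; rewrite gt //; exact: fg.
by exists x => //; exact: le_trans yr.
Qed.

Lemma norm_le_distr f g r : norm_le g r -> L0 a f ->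
  (forall l : R, 0 <= l -> distr_fun a f l = distr_fun a g l) -> norm_le f r.
Proof.
move=> [y gy yr] mf fg; have [|x [fx xy]] := hS f y mf.
  by move=> l l0; rewrite fg //; apply/esym/distr_ae => //; exact: ltW.
by exists x => //; rewrite xy.
Qed.

Lemma norm_leD f g r s : norm_le f r -> norm_le g s ->
  norm_le (fun t => f t + g t)%E (r + s).
Proof.
move=> [x fx xr] [y gy ys]; exists (x + y); last first.
  by apply: le_trans (ler_normD _ _) _; exact: lerD.
apply: (leb_aeS _ _ _ (leb_aeI _ _ (bfs_add hE x y) (leb_aeI _ _ fx gy))).
by move=> t [h1 [h2 h3]] dt; rewrite h1 // h2 // h3.
Qed.

Lemma norm_leZ f r c : 0 <= c -> norm_le f r ->
  norm_le (fun t => c%:E * f t)%E (c * r).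
Proof.
move=> c0 [x fx xr]; exists (c *: x); last first.
  by rewrite normrZ ger0_norm // ler_wpM2l.
apply: (leb_aeS _ _ _ (leb_aeI _ _ (bfs_scale hE c x) fx)).
by move=> t [h1 h2] dt; rewrite h1 // h2.
Qed.

Lemma represents0 : represents (cst 0%E) 0.
Proof.
rewrite -(scale0r (0 : E)).
apply: (leb_aeS _ _ _ (bfs_scale hE 0 0)) => t h dt.
by rewrite h // mul0e.
Qed.

Lemma norm_le_sum (g : nat -> R -> \bar R) r (N : nat) :
  (forall j, (j < N)%N -> norm_le (g j) r) ->
  norm_le (fun t => \sum_(0 <= j < N) g j t)%E (N%:R * r).
Proof.
elim: N => [_|N IH gr].
  exists 0; last by rewrite normr0 mul0r.
  by apply: (leb_aeS _ _ _ represents0) => t h dt; rewrite h // big_geq.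
have := norm_leD _ _ _ _ (IH (fun j jN => gr j (leqW jN))) (gr N (ltnSn N)).
move=> [x xg xr]; exists x; last by rewrite -natr1 mulrDl mul1r.
by apply: (leb_aeS _ _ _ xg) => t h dt; rewrite h // big_nat_recr.
Qed.

(** * Flattening by averages of cyclic shifts *)

Definition flatten_on f p q c : R -> \bar R :=
  fun t => if (p <= t) && (t < q) then c%:E else f t.

Lemma flatten_on_L0 f p q c : profile a f -> 0 <= c -> L0 a (flatten_on f p q c).
Proof.
move=> pf c0; apply: L0_nonneg => [t [t0 _]|l l0].
  by rewrite /flatten_on; case: ifP => _; [rewrite lee_fin|exact: pf.1].
have [d d0 [fd _]] := profile_superlevel f l pf l0.
have mpq : measurable (`[p, q[%classic : set (lebesgueTypeR R)).
  exact: measurable_leb_itv.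
have -> : [set s | dom a s /\ (l%:E < flatten_on f p q c s)%E] =
   (([set s | dom a s /\ (l%:E < f s)%E] `\` `[p, q[) `|`
    (dom a `&` (`[p, q[ `&` [set s | l < c]))).
  apply/seteqP; split => s; rewrite /flatten_on /= in_itv /=.
    move=> [ds]; case: ifP => pqs h; first by right; split=> //; split.
    by left; split=> //; rewrite pqs.
  by move=> [[[ds ls] /negP/negbTE ->]|[ds [-> lc]]]; split; [exact: ds| |exact: ds|].
rewrite fd; apply: measurableU.
  by apply: measurableD => //; exact: measurable_below.
apply: measurableI; first by rewrite domE; apply: measurable_below; exact: ltW.
apply: measurableI => //.
have [lc|lc] := boolP (l < c); first by rewrite (_ : mkset _ = setT) //; apply/seteqP.
by rewrite (_ : mkset _ = set0) //; apply/seteqP; split=> // s.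
Qed.

Lemma sum_cst (z : \bar R) (N : nat) : (0 <= z)%E ->
  (\sum_(0 <= j < N) z = N%:R%:E * z)%E.
Proof.
move=> z0; elim: N => [|N IH]; first by rewrite big_geq // mul0e.
by rewrite big_nat_recr //= IH -natr1 EFinD ge0_muleDl ?lee_fin // mul1e.
Qed.

Lemma profile_cst0 : profile a (cst 0%E).
Proof.
split=> // l l0; exists 0%E; split=> //; first exact: ltW.
by move=> t t0; rewrite !lte_fin !ltNge l0 t0.
Qed.

(** Off [[p, q)] each shift agrees with [f]; on it, [sum_cyc_ge] bounds the average from below by an
    integral that misses the first cell. The strict inequality pays for this cell. *)
Lemma norm_le_flatten_lt f p q c r : profile a f -> norm_le f r ->
  0 <= p -> p < q -> (q%:E <= a)%E -> 0 <= c ->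
  ((c * (q - p))%:E < itg f p q)%E -> norm_le (flatten_on f p q c) r.
Proof.
move=> pf fr p0 pq qa c0 cint; have nf := profile_nonneg_L0 pf.
have [d d0 dint] := itg_cont f p q _ nf p0 cint.
have qp0 : 0 < q - p by rewrite subr_gt0.
(* [N] makes the lost cell so short that the remaining integral still exceeds [c * (q - p)]. *)
have [N N0 hd] : exists2 N : nat, (0 < N)%N & (q - p) / N%:R <= d.
  have [n _ /(_ n (leqnn n)) /= ln] := near_infty_natSinv_lt (PosNum (divr_gt0 d0 qp0)).
  by exists n.+1 => //; rewrite mulrC -ler_pdivlMr // ltW.
pose h := (q - p) / N%:R.
have Nr0 : 0 < N%:R :> R by rewrite ltr0n.
have h0 : 0 < h by rewrite divr_gt0.
have Nh : N%:R * h = q - p by rewrite /h mulrC divfK // gt_eqF.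
have gr j : (j < N)%N -> norm_le (f \o cyc p q (j%:R * h)) r.
  move=> jN; have jh0 : 0 <= j%:R * h by rewrite mulr_ge0 // ltW.
  have jhqp : j%:R * h < q - p by rewrite -Nh ltr_pM2r // ltr_nat.
  apply: (norm_le_distr _ f) => //; first exact: (cyc_L0 p q).
  by move=> l l0; exact: (cyc_distr p q).
have iN0 : 0 <= N%:R^-1 :> R by rewrite invr_ge0 ltW.
have := norm_leZ _ _ _ iN0 (norm_le_sum _ _ _ gr).
rewrite mulrA mulVf ?mul1r ?gt_eqF // => mean.
apply: norm_le_ideal mean _ _; first exact: flatten_on_L0.
move=> t [t0 ta].
have S0 : (0 <= \sum_(0 <= j < N) (f \o cyc p q (j%:R * h)%R) t)%E.
  by apply: sume_ge0 => j _; apply: pf.1; apply: cyc_ge0 => //; rewrite mulr_ge0 // ltW.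
rewrite [leRHS]gee0_abs; last by rewrite mule_ge0.
rewrite /flatten_on; case: ifPn => [/andP[pt tq]|pqt]; last first.
  rewrite gee0_abs ?pf.1 //.
  under eq_bigr do rewrite /= /cyc (negbTE pqt).
  rewrite sum_cst ?pf.1 // muleA -EFinM mulVf ?mul1e //.
  by rewrite gt_eqF.
rewrite gee0_abs ?lee_fin //.
have := sum_cyc_ge p q p0 pq f N h t pf h0 Nh pt tq.
have hh := dint h (ltW h0) hd.
move/(lt_le_trans hh) => {}hh.
have qi : (0 <= ((q - p)^-1)%:E)%E by rewrite lee_fin invr_ge0 ltW.
have := lee_wpmul2l qi (ltW hh); rewrite muleA -!EFinM.
have -> : (q - p)^-1 * (c * (q - p)) = c by field; rewrite gt_eqF.
by have -> : (q - p)^-1 * h = N%:R^-1 by rewrite /h; field; rewrite !gt_eqF.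
Qed.

(** For [c > 0] the level [th * c] with [th < 1] satisfies the strict inequality; scaling back costs
    a factor [th^-1], which tends to 1. *)
Lemma norm_le_flatten f p q c r : profile a f -> norm_le f r ->
  0 <= p -> p < q -> (q%:E <= a)%E -> 0 <= c ->
  ((c * (q - p))%:E <= itg f p q)%E -> norm_le (flatten_on f p q c) r.
Proof.
move=> pf fr p0 pq qa c0 cint.
have [c00|cn0] := eqVneq c 0.
  apply: norm_le_ideal fr _ _; first exact: flatten_on_L0.
  move=> t [t0 _]; rewrite /flatten_on; case: ifP => // _.
  by rewrite c00 abse0 abse_ge0.
have {}c0 : 0 < c by rewrite lt_neqAle eq_sym cn0.
have fl (th : R) : 0 < th -> th < 1 -> norm_le (flatten_on f p q c) (th^-1 * r).
  move=> th0 th1.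
  have : norm_le (flatten_on f p q (th * c)) r.
    apply: norm_le_flatten_lt => //; first by rewrite mulr_ge0 // ltW.
    apply: lt_le_trans cint; rewrite lte_fin ltr_pM2r ?subr_gt0 //.
    by rewrite gtr_pMl.
  have thi0 : 0 <= th^-1 by rewrite invr_ge0 ltW.
  move=> /(norm_leZ _ _ _ thi0) H; apply: norm_le_ideal H _ _.
    by apply: flatten_on_L0 => //; exact: ltW.
  move=> t [t0 _]; rewrite /flatten_on; case: ifP => _.
    by rewrite -EFinM mulrA mulVf ?mul1r ?gt_eqF.
  rewrite abseM lee_pemull ?abse_ge0 //=.
  by rewrite lee_fin ger0_norm // invf_ge1 // ltW.
have [x fx _] := fl (1/2) ltac:(lra) ltac:(lra).
exists x => //; apply/ler_addgt0Pr => e e0.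
have xr (th : R) : 0 < th -> th < 1 -> th * `|x| <= r.
  move=> th0 th1; have := norm_leP _ _ _ fx (fl th th0 th1).
  by rewrite ler_pdivlMl.
have x0 : 0 <= `|x| by [].
have [xe|xe] := leP `|x| e.
  have := xr (1/2) ltac:(lra) ltac:(lra); lra.
(* For this factor, [th * |x|] is [|x| - e]. *)
have := xr (1 - e / `|x|).
have xp : 0 < `|x| by lra.
rewrite mulrBl mul1r divfK ?gt_eqF // subr_gt0 ltr_pdivrMr // mul1r => /(_ xe).
by rewrite ltrBlDr ltrDl divr_gt0 // => /(_ isT); rewrite lerBlDr.
Qed.

(** If the integral over [[0, q')] were infinite, every constant [c] on that interval would have
    norm at most [r]; the indicator would have norm at most [r / c] for all [c], hence be zero. *)
Lemma itg_fin f r q : profile a f -> norm_le f r -> 0 <= q ->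
  (itg f 0 q < +oo)%E.
Proof.
move=> pf fr; have nf := profile_nonneg_L0 pf.
suff fin q' : 0 < q' -> (q'%:E <= a)%E -> (itg f 0 q' < +oo)%E.
  move=> q0.
  have [qa|aq] := leP q%:E a.
    by move: q0; rewrite le_eqVlt => /predU1P[<-|q0]; [rewrite itg_nil|exact: fin].
  have [b ab] : exists b, a = b%:E.
    by case: a aq a0 => [b| |] // _ _; exists b.
  have b0 : 0 < b by rewrite -lte_fin -ab.
  have bq : b < q by rewrite -lte_fin -ab.
  rewrite (itg_cat _ _ b) //; [|exact: ltW|exact: ltW].
  rewrite (@eq_itg _ f (cst 0%E) b q) ?itg_cst ?mul0r ?adde0; last 2 first.
  - exact: ltW.
  - move=> t bt _; apply: (profile_out _ _ pf); first exact: (le_trans (ltW b0)).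
    by rewrite ab lee_fin.
  by apply: fin => //; rewrite ab.
move=> q0 qa; rewrite ltey; apply/eqP => foo.
have fl c : 0 <= c -> norm_le (flatten_on (cst 0%E) 0 q' c) r.
  move=> c0; have : norm_le (flatten_on f 0 q' c) r.
    by apply: norm_le_flatten_lt => //; rewrite foo ltry.
  move=> /norm_le_ideal; apply; first exact: flatten_on_L0 profile_cst0 c0.
  move=> t [t0 _]; rewrite /flatten_on; case: ifP => // _.
  by rewrite abse0 abse_ge0.
have [x fx xr] := fl 1 ler01.
have {fl} xc c : 0 < c -> `|x| <= c^-1 * r.
  move=> c0; apply: norm_leP fx _.
  have ci0 : 0 <= c^-1 by rewrite invr_ge0 ltW.
  have := norm_leZ _ _ _ ci0 (fl c (ltW c0)) => /norm_le_ideal; apply.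
    exact: flatten_on_L0 profile_cst0 ler01.
  move=> t _; rewrite /flatten_on; case: ifP => _; last by rewrite /cst mule0.
  by rewrite -EFinM mulVf ?gt_eqF.
have x0 : x = 0.
  apply/eqP; rewrite -normr_eq0 eq_le normr_ge0 andbT leNgt; apply/negP => x0.
  have r10 : 0 < r + 1 by apply: lt_le_trans x0 _; lra.
  have := xc ((r + 1) / `|x|) (divr_gt0 r10 x0).
  rewrite invf_div mulrAC ler_pdivlMr // ler_pM2l //; lra.
rewrite {}x0 in fx.
have [N [mN N0 sN]] := leb_aeI _ _ fx represents0.
have : (leb R `[0%R, q'[ <= leb R N)%E.
  apply: le_leb => t; rewrite /= in_itv /= => tq; apply: sN => /= -[].
  have dt : dom a t.
    by case/andP: tq => t0 tq; split=> //; apply: lt_le_trans qa; rewrite lte_fin.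
  move=> /(_ dt) -> /(_ dt); rewrite /flatten_on tq /= => -[] /eqP.
  by rewrite oner_eq0.
by rewrite N0 (leb_itv_co 0 q' (ltW q0)) subr0 lee_fin leNgt q0.
Qed.

(** * Cutting a primitive by lines *)

Lemma le0_of_weighted (w v x z : R) : 0 < w -> 0 <= v -> 0 <= z ->
  w * x + v * z <= 0 -> x <= 0.
Proof.
move=> w0 v0 z0 h; rewrite -(pmulr_rle0 _ w0); apply: le_trans h.
by rewrite lerDl mulr_ge0.
Qed.

(** A level [s] between the values on both sides keeps [f] nonincreasing: superlevel sets extend at
    least to [q] for levels below [s] and stop at [p] or earlier for the others. *)
Lemma profile_flatten f p q s : profile a f -> 0 <= p -> p <= q ->
  (q%:E <= a)%E -> 0 <= s ->
  (forall t, 0 <= t -> t < p -> (s%:E <= f t)%E) ->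
  (forall t, q <= t -> (f t <= s%:E)%E) ->
  profile a (flatten_on f p q s).
Proof.
move=> pf p0 pq qa s0 fp fq; split => [t t0|l l0].
  by rewrite /flatten_on; case: ifP => _; [rewrite lee_fin|exact: pf.1].
have [c [c0 ca fc]] := pf.2 l l0.
have q0 := le_trans p0 pq.
have [ls|sl] := ltP l s.
  exists (Order.max c q%:E); split; first by rewrite le_max c0.
    by rewrite ge_max ca.
  move=> t t0; rewrite /flatten_on lt_max.
  case: ifPn => [/andP[pt tq]|]; first by rewrite !lte_fin ls tq orbT.
  rewrite negb_and -ltNge -leNgt => /orP[tp|qt].
    rewrite [RHS](_ : _ = true); first by rewrite (lt_le_trans _ (fp t t0 tp)) // lte_fin.
    by apply/orP; right; rewrite lte_fin (lt_le_trans tp).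
  by rewrite fc // [X in _ || X]lte_fin (ltNge t) qt orbF.
exists (Order.min c p%:E); split; first by rewrite le_min c0 lee_fin.
  by rewrite ge_min ca.
move=> t t0; rewrite /flatten_on lt_min.
case: ifPn => [/andP[pt tq]|]; first by rewrite !lte_fin (ltNge l) sl (ltNge t) pt andbF.
rewrite negb_and -ltNge -leNgt => /orP[tp|qt]; first by rewrite fc // lte_fin tp andbT.
rewrite [X in _ && X]lte_fin (ltNge t) (le_trans pq qt) andbF.
by apply/negbTE; rewrite -leNgt (le_trans (fq t qt)) // lee_fin.
Qed.

Lemma vanishing_after f T0 e : profile a f -> vanishing f -> 0 < e -> 0 <= T0 ->
  exists2 T, T0 <= T & forall t, T <= t -> (f t <= e%:E)%E.
Proof.
move=> pf vf e0 T00; have [T TT fT] := vf e e0.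
exists (Num.max T T0); first by rewrite le_max lexx orbT.
move=> t; rewrite ge_max => /andP[Tt _]; apply: le_trans fT.
exact: profile_nonincr pf TT Tt.
Qed.

(** By concavity the gap [g] between [prim f] and the line is positive on one interval, and there
    [f] is replaced by the slope. Beyond [a] the formula can fail: if the line is still below
    [prim f] at [a], the minimum keeps growing while [prim y] is constant. *)
Lemma cut_line f r s b : profile a f -> norm_le f r -> vanishing f ->
  0 < s -> 0 <= b -> exists y, [/\ profile a y, norm_le y r, vanishing y &
    forall t, 0 <= t -> (t%:E <= a)%E -> prim y t = Num.min (prim f t) (b + s * t)].
Proof.
move=> pf fr vf s0 b0.
have fin q := itg_fin f r q pf fr.
pose g t := prim f t - (b + s * t).
have [[t0 [t00 t0a gt0]]|nog] := pselect (exists t0,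
    [/\ 0 <= t0, (t0%:E <= a)%E & 0 < g t0]); last first.
  exists f; split=> // t tt ta; rewrite min_l // leNgt; apply/negP => h.
  by apply: nog; exists t; split=> //; rewrite subr_gt0.
have gc : continuous g.
  move=> t; apply: cvgB; first exact: (prim_continuous pf fin).
  by apply: cvgD; [exact: cvg_cst|apply: cvgM; [exact: cvg_cst|exact: cvg_id]].
have g0 : g 0 <= 0 by rewrite /g prim0; lra.
have gconc u v w : 0 <= u -> u <= v -> v <= w ->
    (w - v) * g u + (v - u) * g w <= (w - u) * g v.
  move=> u0 uv vw; have := prim_concave pf fin u v w u0 uv vw.
  by rewrite /g; move: (prim f u) (prim f v) (prim f w) => x y z; nra.
have [t1 [t10 t1t0 gt1]] : exists c, [/\ 0 <= c, c <= t0 & g c = 0].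
  by apply: continuous_crossing => //; left; split=> //; exact: ltW.
have {}t1t0 : t1 < t0.
  by rewrite lt_neqAle t1t0 andbT; apply/eqP => h; move: gt0; rewrite -h gt1 ltxx.
(* Right end of the interval: a second zero of [g], or [a] itself when it is finite and [g] is still
   positive there. *)
have [t2 [t0t2 t2a gt2 gt2a]] : exists t2, [/\ t0 <= t2, (t2%:E <= a)%E, 0 <= g t2 &
    g t2 = 0 \/ t2%:E = a].
  have cross T : t0 <= T -> (T%:E <= a)%E -> g T <= 0 -> exists t2,
      [/\ t0 <= t2, (t2%:E <= a)%E, 0 <= g t2 & g t2 = 0 \/ t2%:E = a].
    move=> t0T Ta gT; have [c [t0c cT gc0]] : exists c, [/\ t0 <= c, c <= T & g c = 0].
      by apply: continuous_crossing => //; right; split=> //; exact: ltW.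
    exists c; split=> //; [|by rewrite gc0|by left].
    by apply: le_trans Ta; rewrite lee_fin.
  case aE : a => [A| |]; last 2 first.
  (* From [T + 1] on, [prim f] grows with slope at most [s / 2], so the line has caught up after a
     further length [2 * prim f (T + 1) / s]. The added 1 keeps the argument of [fval] positive. *)
  - have sh : 0 < s / 2 by lra.
    have [T t0T fT] := vanishing_after f t0 (s / 2) pf vf sh t00.
    have T0 : 0 < T + 1 by lra.
    have vT : fval f (T + 1) <= s / 2.
      by rewrite -lee_fin (fvalE pf fin) // fT // lerDl.
    have Un : 0 <= prim f (T + 1) by apply: (prim_ge0 pf fin); exact: ltW.
    pose t := T + 1 + 2 * prim f (T + 1) / s.
    have tT : T + 1 <= t by rewrite /t lerDl divr_ge0 ?mulr_ge0 // ltW.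
    rewrite -aE; apply: (cross t); [by lra|by rewrite aE leey|].
    have sg := prim_supergradient pf fin (T + 1) t T0 ltac:(lra).
    have : (t - (T + 1)) * fval f (T + 1) <= (t - (T + 1)) * (s / 2).
      by rewrite ler_wpM2l // subr_ge0.
    have -> : (t - (T + 1)) * (s / 2) = prim f (T + 1).
      by rewrite /t; field; rewrite gt_eqF.
    have : s * t = s * (T + 1) + 2 * prim f (T + 1).
      by rewrite /t; field; rewrite gt_eqF.
    have : 0 <= s * (T + 1) by rewrite mulr_ge0 // ltW.
    move: sg; clearbody t; rewrite /g.
    move: (prim f t) (prim f (T + 1)) (s * t) (s * (T + 1)) => A B C D.
    move: ((t - (T + 1)) * fval f (T + 1)) => F.
    lra.
  - by move: a0; rewrite aE.
  have t0A : t0 <= A by rewrite -lee_fin -aE.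
  have [gA|gA] := leP (g A) 0; first by rewrite -aE; apply: (cross A) => //; rewrite aE.
  by exists A; split=> //; [exact: ltW|right].
have t1t2 : t1 < t2 by exact: lt_le_trans t0t2.
have t20 : 0 < t2 by exact: le_lt_trans t1t2.
pose y := flatten_on f t1 t2 s.
(* [prim f] meets the line at [t1] and is above it at [t0], so its supergradient at [t1] is at least
   [s]. The bound after [t2] is the mirror image, or holds because [f] vanishes from [t2 = a] on. *)
have fy1 t : 0 <= t -> t < t1 -> (s%:E <= f t)%E.
  move=> tt tt1; have t1p : 0 < t1 by exact: le_lt_trans tt1.
  apply: (@le_trans _ _ (f t1)); last exact: profile_nonincr pf tt (ltW tt1).
  rewrite -(fvalE pf fin) // lee_fin.
  have := prim_supergradient pf fin t1 t0 t1p t00.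
  move: gt0 gt1; rewrite /g; move: (prim f t0) (prim f t1) (fval f t1) => x z v; nra.
have fy2 t : t2 <= t -> (f t <= s%:E)%E.
  move=> t2t; apply: (@le_trans _ _ (f t2)).
    exact: profile_nonincr pf (ltW t20) t2t.
  case: gt2a => [gt20|t2A]; last first.
    by rewrite (profile_out f t2 pf) ?t2A // ?lee_fin ltW.
  have t0t2' : t0 < t2.
    by rewrite lt_neqAle t0t2 andbT; apply/eqP => h; move: gt0; rewrite h gt20 ltxx.
  rewrite -(fvalE pf fin) // lee_fin.
  have := prim_supergradient pf fin t2 t0 t20 t00.
  move: gt0 gt20; rewrite /g; move: (prim f t0) (prim f t2) (fval f t2) => x z v; nra.
have py : profile a y by apply: profile_flatten => //; exact: ltW.
(* The mean of [f] over [[t1, t2)] is at least [s], because [g t1 = 0 <= g t2]. *)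
have ny : norm_le y r.
  apply: (norm_le_flatten) => //; first exact: ltW.
  rewrite (itg_prim pf fin) ?(ltW t1t2) // lee_fin.
  by move: gt1 gt2; rewrite /g; move: (prim f t1) (prim f t2) => x z; nra.
have vy : vanishing y.
  move=> e e0; have [T t2T fT] := vanishing_after f t2 e pf vf e0 (ltW t20).
  exists T; first by lra.
  by rewrite /y /flatten_on (ltNge T) t2T andbF; exact: fT.
exists y; split=> // t tt ta.
have finy q := itg_fin y r q py ny.
have nf := profile_nonneg_L0 pf.
have gP : (prim f t <= b + s * t) = (g t <= 0) by rewrite subr_le0.
have gP' : (b + s * t <= prim f t) = (0 <= g t) by rewrite subr_ge0.
have y1 u : 0 <= u -> u <= t1 -> prim y u = prim f u.
  move=> u0 ut1; rewrite /prim; congr fine; apply: eq_itg => v v0 vu.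
  by rewrite /y /flatten_on leNgt (lt_le_trans vu ut1).
have y2 u : t1 <= u -> u <= t2 -> prim y u = prim y t1 + s * (u - t1).
  move=> t1u ut2; apply/eqP; rewrite -subr_eq0 opprD addrA subr_eq0 -eqe.
  rewrite -(itg_prim py finy) // -itg_cst // (@eq_itg _ y (cst s%:E)) //.
  by move=> v v1 vu; rewrite /y /flatten_on v1 (lt_le_trans vu ut2).
have [tt1|t1t] := leP t t1.
  rewrite y1 // min_l // gP.
  have := gconc t t1 t0 tt tt1 (ltW t1t0); rewrite gt1 mulr0.
  by apply: le0_of_weighted; [lra|lra|exact: ltW].
have [tt2|t2t] := leP t t2.
  rewrite y2 ?(ltW t1t) // y1 // min_r.
    by move: gt1; rewrite /g; move: (prim f t1) => x; lra.
  rewrite gP'; have := gconc t1 t t2 t10 (ltW t1t) tt2; rewrite gt1 mulr0 add0r => h.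
  have w0 : 0 < t2 - t1 by lra.
  by rewrite -(pmulr_rge0 _ w0); apply: le_trans h; rewrite mulr_ge0 //; lra.
have gt20 : g t2 = 0.
  by case: gt2a => // t2A; move: ta; rewrite -t2A lee_fin leNgt t2t.
rewrite min_l; last first.
  rewrite gP; have t0t2' : t0 < t2.
    by rewrite lt_neqAle t0t2 andbT; apply/eqP => h; move: gt0; rewrite h gt20 ltxx.
  have := gconc t0 t2 t t00 t0t2 (ltW t2t); rewrite gt20 mulr0 addrC.
  by apply: le0_of_weighted; [lra|lra|exact: ltW].
have : prim y t - prim y t2 = prim f t - prim f t2.
  apply/eqP; rewrite -eqe -(itg_prim py finy) ?(ltW t20) ?(ltW t2t) //.
  rewrite -(itg_prim pf fin) ?(ltW t20) ?(ltW t2t) //; apply/eqP.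
  by apply: eq_itg => v t2v _; rewrite /y /flatten_on (ltNge v) t2v andbF.
rewrite (y2 t2 (ltW t1t2) (lexx t2)) (y1 t1 t10 (lexx t1)).
move: gt1 gt20; rewrite /g; move: (prim f t1) (prim f t2) (prim f t) (prim y t) => A B C D; lra.
Qed.

(** Tangents of [prim g] stay above it, so each cut keeps [prim g <= prim y]; at its own grid point
    it forces the reverse inequality, which later cuts preserve. Points of slope zero are skipped,
    as [cut_line] needs a positive slope. *)
Lemma cut_grid f g r r' h (m : nat) :
  profile a f -> norm_le f r -> vanishing f ->
  profile a g -> norm_le g r' -> 0 < h ->
  (forall t, 0 <= t -> (t%:E <= a)%E -> prim g t <= prim f t) ->
  exists y, [/\ profile a y, norm_le y r, vanishing y,
    forall t, 0 <= t -> (t%:E <= a)%E -> prim g t <= prim y t &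
    forall i : nat, (0 < i <= m)%N -> ((i%:R * h)%:E <= a)%E ->
      0 < fval g (i%:R * h) -> prim y (i%:R * h) <= prim g (i%:R * h)].
Proof.
move=> pf fr vf pg gr h0 gf.
have fing q := itg_fin g r' q pg gr.
elim: m => [|m [y [py yr vy gy yg]]].
  by exists f; split=> // i; rewrite leqn0; case: i.
pose s := m.+1%:R * h.
have s0 : 0 < s by rewrite mulr_gt0.
have [[sa vs0]|ns] := pselect ((s%:E <= a)%E /\ 0 < fval g s); last first.
  exists y; split=> // i /andP[i0]; rewrite leq_eqVlt => /predU1P[->|im].
    by move=> sa vs0; case: ns.
  by apply: yg; rewrite i0.
have sg t : 0 <= t -> prim g t <= prim g s + (t - s) * fval g s.
  exact: (prim_supergradient pg fing).
pose b := prim g s - s * fval g s.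
have b0 : 0 <= b.
  have := sg 0 (lexx 0); rewrite prim0 sub0r mulNr.
  by rewrite /b; move: (prim g s) (s * fval g s) => x z; lra.
have [y' [py' yr' vy' y'E]] := cut_line y r (fval g s) b py yr vy vs0 b0.
exists y'; split=> // [t t0 ta|i].
  rewrite y'E // le_min gy //=; apply: le_trans (sg t t0) _.
  by rewrite /b; move: (prim g s) (fval g s) => x z; lra.
move=> /andP[i0]; rewrite leq_eqVlt => /predU1P[->|im] ia vi.
  rewrite y'E //; last exact: ltW.
  rewrite ge_min; apply/orP; right; rewrite /b -/s.
  by move: (prim g s) (fval g s) => x z; lra.
rewrite y'E // ?ge_min ?yg // ?i0 //.
by rewrite mulr_ge0 // ltW.
Qed.

(** On a grid cell [[s, s']] the increment of [prim y] is at least that of [prim g], so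
    [y s >= g s'] by monotonicity. The shift of two cells comes from [t < s] and
    [s' <= t + 2 * h]. *)
Lemma cut_grid_ge f g r r' h (m : nat) :
  profile a f -> norm_le f r -> vanishing f ->
  profile a g -> norm_le g r' -> 0 < h ->
  (forall t, 0 <= t -> (t%:E <= a)%E -> prim g t <= prim f t) ->
  exists y, [/\ profile a y, norm_le y r &
    forall t, 0 <= t -> t + 2 * h <= m%:R * h -> (g (t + 2 * h)%R <= y t)%E].
Proof.
move=> pf fr vf pg gr h0 gf.
have fing q := itg_fin g r' q pg gr.
have [y [py yr _ gy yg]] := cut_grid f g r r' h m pf fr vf pg gr h0 gf.
have finy q := itg_fin y r q py yr.
exists y; split=> // t t0 tm.
have th0 : 0 <= t / h by rewrite divr_ge0 // ltW.
pose i := Num.truncn (t / h).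
have /andP[it ti] : (i%:R * h <= t < i.+1%:R * h).
  by rewrite -ler_pdivlMr // -ltr_pdivrMr //; exact: truncn_itv.
have t2h : 0 < t + 2 * h by lra.
(* Where [g] vanishes there is nothing to prove; otherwise both grid points have positive slope and
   do not exceed [a], as [cut_grid] requires. *)
have [g0|gn0] := eqVneq (g (t + 2 * h)) 0%E; first by rewrite g0 py.1.
have {gn0} gp : 0 < fval g (t + 2 * h).
  rewrite -lte_fin (fvalE pg fing) // lt_neqAle eq_sym gn0 /=.
  by apply: pg.1; exact: ltW.
pose s := i.+1%:R * h; pose s' := i.+2%:R * h.
have s's : s' = s + h by rewrite /s' /s -(@natr1 _ i.+1) mulrDl mul1r.
have s0 : 0 < s by rewrite mulr_gt0.
have ts : t < s by [].
have s't : s' <= t + 2 * h.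
  by rewrite s's /s -natr1 mulrDl mul1r; lra.
have s'0 : 0 < s' by lra.
have gs' : fval g (t + 2 * h) <= fval g s' by exact: (fval_nonincr pg fing).
have gs : fval g s' <= fval g s by apply: (fval_nonincr pg fing) => //; lra.
have s'a : (s'%:E <= a)%E.
  rewrite leNgt; apply/negP => as'.
  have := profile_out g s' pg (ltW s'0) (ltW as').
  rewrite -(fvalE pg fing) // => -[gs'0].
  by move: gs'; rewrite gs'0 leNgt gp.
have sa : (s%:E <= a)%E by apply: le_trans s'a; rewrite lee_fin; lra.
have im : (i.+1 <= m)%N.
  have : s' <= m%:R * h by lra.
  by rewrite ler_pM2r // ler_nat => /ltnW.
have h1 : prim y s <= prim g s by apply: yg => //; lra.
have h2 := gy s' (ltW s'0) s'a.
have h3 := prim_supergradient py finy s s' s0 (ltW s'0).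
have h4 := prim_supergradient pg fing s' s s'0 (ltW s0).
have {h1 h2 h3 h4} : h * fval g s' <= h * fval y s.
  have E1 : s' - s = h by lra.
  have E2 : s - s' = - h by lra.
  move: h3 h4; rewrite E1 E2 mulNr => h3 h4.
  move: h1 h2 h3 h4.
  move: (prim y s) (prim g s) (prim y s') (prim g s') (h * fval g s') (h * fval y s).
  by move=> x1 x2 x3 x4 x5 x6; lra.
rewrite ler_pM2l // => gys.
apply: (@le_trans _ _ (y s)); last exact: profile_nonincr py t0 (ltW ts).
rewrite -(fvalE pg fing) // -(fvalE py finy) // lee_fin.
exact: le_trans gys.
Qed.

Lemma lte_subr_shift (c : \bar R) t s :
  (t%:E < c - s%:E)%E = ((t + s)%:E < c)%E.
Proof.
case: c => [c| |] //=; first by rewrite -EFinB !lte_fin ltrBrDr.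
by rewrite !ltry.
Qed.

(** The shift absorbs the loss in [cut_grid_ge]; the cut at [T] is there because a grid is
    finite. *)
Definition shift_cut g h T t : \bar R := if t < T then g (t + 2 * h)%R else 0%E.

Lemma profile_shift_cut g h T : profile a g -> 0 <= h -> 0 <= T ->
  profile a (shift_cut g h T).
Proof.
move=> pg h0 T0; split => [t t0|l l0].
  by rewrite /shift_cut; case: ifP => // _; apply: pg.1; lra.
have [c [c0 ca gc]] := pg.2 l l0.
have h20 : 0 <= 2 * h by lra.
exists (Order.max 0 (Order.min T%:E (c - (2 * h)%:E)))%E; split.
- by rewrite le_max lexx.
- rewrite ge_max (ltW a0) /= ge_min; apply/orP; right.
  apply: le_trans ca; rewrite -[leRHS]adde0; apply: leeD2l.
  by rewrite lee_fin oppr_le0.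
- move=> t t0; rewrite lt_max lte_fin [t < 0]ltNge t0 orFb lt_min lte_fin /shift_cut.
  case: ifPn => tT; last by rewrite lte_fin (ltNge l) l0.
  rewrite gc; last by lra.
  by rewrite andTb lte_subr_shift.
Qed.

(** The functions [w n] are dominated by cut versions of [f] and increase to [g] by
    right-continuity, so the Fatou property transfers the bound. The a priori bound [r'] supplies
    the local integrability of [g]. *)
Lemma norm_le_hlp f g r r' :
  profile a f -> norm_le f r -> vanishing f ->
  profile a g -> norm_le g r' ->
  (forall t, 0 <= t -> (t%:E <= a)%E -> prim g t <= prim f t) -> norm_le g r.
Proof.
move=> pf fr vf pg gr gf.
pose h (n : nat) : R := n.+1%:R^-1.
have h0 n : 0 < h n by rewrite invr_gt0.
have hS' n : h n.+1 <= h n by rewrite lef_pV2 ?posrE // ler_nat.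
pose w n := shift_cut g (h n) n%:R.
have pw n : profile a (w n) by apply: profile_shift_cut => //; exact: ltW.
have wr n : norm_le (w n) r.
  (* With [h n = 1/(n+1)] this many cells reach [n + 2], beyond [t + 2 * h n] for all [t < n]. *)
  have [y [py yr gy]] := cut_grid_ge f g r r' (h n) (n.+2 * n.+1) pf fr vf pg gr (h0 n) gf.
  apply: norm_le_ideal yr _ _ => //; first exact: profile_L0.
  move=> t [t0 _]; rewrite !gee0_abs; [|exact: py.1|exact: (pw n).1].
  rewrite /w /shift_cut; case: ifPn => tn; last exact: py.1.
  apply: gy => //.
  have -> : (n.+2 * n.+1)%:R * h n = n%:R + 2.
    by rewrite natrM -mulrA divff ?mulr1 // -addn2 natrD.
  have : h n <= 1 by rewrite invf_le1 // ler1n.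
  by move: (h n) => x; lra.
have /choice[x_ x_P] n : exists x, represents (w n) x /\ `|x| <= r.
  by have [x wx xr] := wr n; exists x.
have wS t n : 0 <= t -> (w n t <= w n.+1 t)%E.
  move=> t0; rewrite /w /shift_cut; case: ifPn => tn; last exact: (pw n.+1).1.
  have -> : t < n.+1%:R by rewrite (lt_le_trans tn) // ler_nat.
  apply: profile_nonincr pg _ _; first by have := h0 n.+1; lra.
  by have := hS' n; lra.
have wg t n : 0 <= t -> (w n t <= g t)%E.
  move=> t0; rewrite /w /shift_cut; case: ifPn => tn; last exact: pg.1.
  by apply: profile_nonincr pg t0 _; have := h0 n; lra.
have wcvg t : 0 <= t -> w n t @[n --> \oo] --> g t.
  move=> t0; suff <- : ereal_sup (range (fun n => w n t)) = g t.
    by apply: ereal_nondecreasing_cvgn; apply/nondecreasing_seqP => n; exact: wS.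
  apply/eqP; rewrite eq_le; apply/andP; split.
    by apply: ge_ereal_sup => _ [n _ <-]; exact: wg.
  rewrite leNgt; apply/negP => sg.
  have s0 : (0 <= ereal_sup (range (fun n => w n t)))%E.
    apply: (@le_trans _ _ (w 0%N t)); first exact: (pw 0%N).1.
    by apply: ereal_sup_ubound; exists 0%N.
  case sE : (ereal_sup _) s0 sg => [l| |] // l0 lg; last by move: lg; rewrite ltNge leey.
  have [d d0 gd] := profile_right_cont g l t pg t0 l0 lg.
  have d20 : 0 < d / 2 by lra.
  have [n0 _ n0P] := near_infty_natSinv_lt (PosNum d20).
  pose n := maxn n0 (Num.truncn t).+1.
  have hn : h n < d / 2 by apply: n0P; rewrite /= leq_maxl.
  have tn : t < n%:R.
    have /andP[_ h2] := truncn_itv t0; apply: lt_le_trans h2 _.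
    by rewrite ler_nat leq_maxr.
  have : (l%:E < w n t)%E.
    by rewrite /w /shift_cut tn; apply: gd; have := h0 n; lra.
  rewrite ltNge -sE => /negP; apply.
  by apply: ereal_sup_ubound; exists n.
have [] := hF x_ g.
- move=> n; apply: (leb_aeS _ _ _ (x_P n).1) => t h1 dt.
  by rewrite h1 //; apply: (pw n).1; case: dt.
- by exists r => _ [n _ <-]; exact: (x_P n).2.
- exact: profile_L0.
- move=> n; apply: (leb_aeS _ _ _ (leb_aeI _ _ (x_P n).1 (x_P n.+1).1)).
  by move=> t [h1 h2] dt; rewrite h1 // h2 //; apply: wS; case: dt.
- have : {ae leb R, forall t, forall n, dom a t -> ev (x_ n) t = w n t}.
    apply: (@ae_foralln _ (lebesgueTypeR R) _ (leb R)) => n; exact: (x_P n).1.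
  apply: (leb_aeS) => t h1 dt.
  rewrite (_ : (fun n => ev (x_ n) t) = (fun n => w n t)); first by apply: wcvg; case: dt.
  by apply/funext => n; exact: h1.
- move=> x [gx _ xx]; exists x => //.
  rewrite -(cvg_lim _ xx) //; apply: limr_le; first by apply/cvg_ex; exists `|x|.
  by apply: nearW => n; exact: (x_P n).2.
Qed.

(** * From profiles back to elements of the space *)

Let a0' : (0 <= a)%E := ltW a0.

Lemma rearr_ev_profile (x : E) : profile a (rearr a (ev x)).
Proof. by apply: rearr_profile => //; exact: bfs_L0. Qed.

Lemma represents_ev (x : E) : represents (ev x) x.
Proof. exact: leb_aeW. Qed.

Lemma norm_le_rearr (x : E) r : norm_le (rearr a (ev x)) r <-> `|x| <= r.
Proof.
have mx : L0 a (ev x) by exact: bfs_L0.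
split=> [h|xr].
  apply: (norm_leP (ev x)); first exact: represents_ev.
  by apply: (norm_le_distr _ _ _ h) => // l l0; rewrite distr_rearr.
apply: (norm_le_distr _ (ev x)).
- by exists x => //; exact: represents_ev.
- by apply: profile_L0; exact: rearr_ev_profile.
- by move=> l l0; rewrite distr_rearr.
Qed.

Let fin_rearr (x : E) (q : R) : 0 <= q -> (itg (rearr a (ev x)) 0 q < +oo)%E.
Proof.
apply: (itg_fin _ `|x|); first exact: rearr_ev_profile.
exact/norm_le_rearr.
Qed.

Lemma maxfun_prim (x : E) t : 0 <= t ->
  maxfun a (ev x) t = (t^-1 * prim (rearr a (ev x)) t)%:E.
Proof.
move=> t0; rewrite maxfunE //; last exact: bfs_L0.
by rewrite -(primE (rearr_ev_profile x) (fin_rearr x)) // EFinM.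
Qed.

Lemma hlp_prim (z x : E) : hlp a (ev z) (ev x) <->
  forall t, 0 <= t -> prim (rearr a (ev z)) t <= prim (rearr a (ev x)) t.
Proof.
split=> [h t|h t t0].
  rewrite le_eqVlt => /predU1P[<-|t0]; first by rewrite !prim0.
  have mz := maxfun_prim z t (ltW t0); have mx := maxfun_prim x t (ltW t0).
  move: (h t t0); rewrite mz mx lee_fin; move: (prim _ _) (prim _ _) => A B.
  by rewrite ler_pM2l // invr_gt0.
have mz := maxfun_prim z t (ltW t0); have mx := maxfun_prim x t (ltW t0).
move: (h t (ltW t0)); rewrite mz mx lee_fin; move: (prim _ _) (prim _ _) => A B.
by apply: ler_wpM2l; rewrite invr_ge0 ltW.
Qed.

Lemma LKM_strict (x : E) y t0 : LKM_point a ev x -> profile a y ->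
  norm_le y `|x| -> 0 <= t0 -> (t0%:E <= a)%E ->
  (forall t, 0 <= t -> (t%:E <= a)%E -> prim y t <= prim (rearr a (ev x)) t) ->
  prim y t0 < prim (rearr a (ev x)) t0 -> exists2 r, r < `|x| & norm_le y r.
Proof.
move=> lkm py yx t00 t0a yle ylt.
have [z zy zx] := yx.
have zyE t : 0 <= t -> rearr a (ev z) t = y t.
  by move=> tt; rewrite (rearr_ae _ y) // rearr_id.
have primzy t : prim (rearr a (ev z)) t = prim y t.
  by congr fine; apply: eq_itg => u u0 _; exact: zyE.
have finy q := itg_fin y _ q py yx.
exists `|z|; last by exists z.
apply: lkm.
  move=> zx'; have : prim (rearr a (ev z)) t0 = prim (rearr a (ev x)) t0.
    by apply: (f_equal fine); apply: eq_itg => u u0 _; exact (zx' u u0).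
  by rewrite primzy => h; move: ylt; rewrite h ltxx.
apply/hlp_prim => t tt; rewrite primzy.
have [ta|at_] := leP t%:E a; first exact: yle.
have [A aE] : exists A, a = A%:E by case: a at_ a0 => [A| |] // _ _; exists A.
have A0 : 0 <= A by rewrite -lee_fin -aE.
have At : A <= t by rewrite -lee_fin -aE ltW.
have aA : (a <= A%:E)%E by rewrite aE.
rewrite (prim_out py finy A t A0 aA At).
rewrite (prim_out (rearr_ev_profile x) (fin_rearr x) A t A0 aA At).
by apply: yle => //; rewrite aE.
Qed.

(** The bound [r] is independent of [z]: it belongs to the profile cut out by the line, and
    [norm_le_hlp] passes it on. For [b < 0] no [z] qualifies, as primitives vanish at 0. *)
Lemma line_bound (x : E) s b t0 : LKM_point a ev x -> vanishing (rearr a (ev x)) ->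
  0 < s -> 0 <= t0 -> (t0%:E <= a)%E -> b + s * t0 < prim (rearr a (ev x)) t0 ->
  exists2 r, r < `|x| & forall z : E, hlp a (ev z) (ev x) ->
  (forall t, 0 <= t -> (t%:E <= a)%E -> prim (rearr a (ev z)) t <= b + s * t) ->
  `|z| <= r.
Proof.
move=> lkm vx s0 t00 t0a lt0.
have [b0|b0] := leP 0 b; last first.
  exists (`|x| - 1); first by lra.
  move=> z _ /(_ 0 (lexx 0) a0'); rewrite prim0 mulr0 addr0.
  by rewrite leNgt b0.
have px := rearr_ev_profile x.
have xx : norm_le (rearr a (ev x)) `|x| by exact/norm_le_rearr.
have [y [py yx vy yE]] := cut_line _ _ s b px xx vx s0 b0.
have [r rx yr] : exists2 r, r < `|x| & norm_le y r.
  apply: (LKM_strict x y t0) => //; first by move=> t tt ta; rewrite yE // ge_min lexx.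
  by rewrite yE // gt_min lt0 orbT.
exists r => // z zx zl; apply/norm_le_rearr.
have zz : norm_le (rearr a (ev z)) `|z| by exact/norm_le_rearr.
apply: (norm_le_hlp y _ r _ py yr vy (rearr_ev_profile z) zz).
move=> t tt ta; rewrite yE // le_min zl // andbT.
exact: (hlp_prim z x).1.
Qed.

(** * Convergence of the primitives *)

Section Convergence.
Variables (x : E) (x_ : nat -> E).
Hypothesis lkm : LKM_point a ev x.
Hypothesis vx : vanishing (rearr a (ev x)).
Hypothesis hprec : forall n, hlp a (ev (x_ n)) (ev x).
Hypothesis hnorm : `|x_ n| @[n --> \oo] --> `|x|.

Let f := rearr a (ev x).
Let g n := rearr a (ev (x_ n)).
Let pf : profile a f := rearr_ev_profile x.
Let pg n : profile a (g n) := rearr_ev_profile (x_ n).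
Let finf := fin_rearr x.
Let fing n := fin_rearr (x_ n).

Lemma le_prim_hlp n t : 0 <= t -> prim (g n) t <= prim f t.
Proof. exact: (hlp_prim (x_ n) x).1. Qed.

Lemma prim_near_pointwise t0 e : 0 <= t0 -> (t0%:E <= a)%E -> 0 < e ->
  \forall n \near \oo, prim f t0 - prim (g n) t0 <= e.
Proof.
rewrite le_eqVlt => /predU1P[<- _ e0|t00 t0a e0].
  by apply: nearW => n; rewrite !prim0 subrr ltW.
(* Raising the slope by at most [d] lowers a line through [(t0, c)] by at most [d * t0 = e / 2] on
   [[0, t0]], exactly the distance from [c] down to [prim f t0 - e]. *)
pose d := e / (2 * t0).
have d0 : 0 < d by rewrite divr_gt0 // mulr_gt0.
have dt0 : d * t0 = e / 2 by rewrite /d; field; rewrite gt_eqF.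
pose c := prim f t0 - e / 2.
(* Tangents of [prim (g n)] at [t0] have slope at most [prim f t0 / t0], so [K] slopes serve all
   [n]. *)
pose K := (Num.truncn (prim f t0 / t0 / d)).+1.
have bound (k : nat) : exists2 r, r < `|x| & forall z : E, hlp a (ev z) (ev x) ->
    (forall t, 0 <= t -> (t%:E <= a)%E ->
      prim (rearr a (ev z)) t <= c - k.+1%:R * d * t0 + k.+1%:R * d * t) ->
    `|z| <= r.
  apply: (line_bound x (k.+1%:R * d) (c - k.+1%:R * d * t0) t0) => //.
  - by rewrite mulr_gt0.
  - exact: ltW.
  - by rewrite subrK /c -/f; lra.
have /choice[r_ r_P] k : exists r, r < `|x| /\ forall z : E, hlp a (ev z) (ev x) ->
    (forall t, 0 <= t -> (t%:E <= a)%E ->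
      prim (rearr a (ev z)) t <= c - k.+1%:R * d * t0 + k.+1%:R * d * t) ->
    `|z| <= r by have [r rx rP] := bound k; exists r.
(* The tangent of [prim (g n)] at [t0] lies below the line of slope [k.+1 * d]
   through [(t0, c)], where [k] is the integer part of its slope divided by [d]. *)
have : \forall n \near \oo, forall k : 'I_K, r_ k < `|x_ n|.
  by apply: filter_forall => k; apply: cvgr_gt hnorm _ (r_P k).1.
apply: filterS => n rn; rewrite leNgt; apply/negP => gn.
pose s := fval (g n) t0.
have s0 : 0 <= s by apply: (fval_ge0 (pg n)); exact: ltW.
have sg := prim_supergradient (pg n) (fing n) t0.
have sf : s <= prim f t0 / t0.
  rewrite ler_pdivlMr //; apply: le_trans (le_prim_hlp n t0 (ltW t00)).
  have := sg 0 t00 (lexx 0); rewrite prim0 /s sub0r mulNr mulrC.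
  by rewrite subr_ge0.
have sd0 : 0 <= s / d by rewrite divr_ge0 // ltW.
pose k := Num.truncn (s / d).
have kK : (k < K)%N by rewrite ltnS; apply: le_truncn; rewrite ler_pM2r ?invr_gt0.
have /andP[ks sk] : k%:R * d <= s < k.+1%:R * d.
  by rewrite -ler_pdivlMr // -ltr_pdivrMr //; exact: truncn_itv.
have := rn (Ordinal kK); rewrite ltNge => /negP; apply.
apply: (r_P k).2 => // t tt ta.
have h := sg t t00 tt; rewrite -/s in h.
have kd : k.+1%:R * d = k%:R * d + d by rewrite -natr1 mulrDl mul1r.
move: gn; rewrite kd in sk *; move: ks sk h; rewrite -/(g n) /c.
move: (k%:R * d) (prim f t0) (prim (g n) t0) (prim (g n) t) => m A B C ks sk h gn.
have [t0t|tt0] := leP t0 t; nra.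
Qed.

(** [prim (g n)] is monotone and [prim f] uniformly continuous, so a bound at finitely many grid
    points spreads to [[0, T]]. *)
Lemma prim_near_uniform T e : 0 <= T -> (T%:E <= a)%E -> 0 < e ->
  \forall n \near \oo, forall t, 0 <= t -> t <= T -> prim f t - prim (g n) t <= e.
Proof.
move=> T0 Ta e0; have e20 : 0 < e / 2 by lra.
have [d d0 dP] := prim_modulus pf finf (e / 2) e20.
pose K := (Num.truncn (T / d)).+1.
have : \forall n \near \oo, forall k : 'I_K,
    prim f (k%:R * d) - prim (g n) (k%:R * d) <= e / 2.
  apply: filter_forall => k; apply: prim_near_pointwise => //.
    by rewrite mulr_ge0 // ltW.
  apply: le_trans Ta; rewrite lee_fin -ler_pdivlMr //.
  have Td0 : 0 <= T / d by rewrite divr_ge0 // ltW.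
  have /andP[h _] := truncn_itv Td0; apply: le_trans h.
  by rewrite ler_nat -ltnS.
apply: filterS => n kn t t0 tT.
have td0 : 0 <= t / d by rewrite divr_ge0 // ltW.
pose k := Num.truncn (t / d).
have kK : (k < K)%N by rewrite ltnS; apply: le_truncn; rewrite ler_pM2r ?invr_gt0.
have /andP[kt tk] : k%:R * d <= t < k.+1%:R * d.
  by rewrite -ler_pdivlMr // -ltr_pdivrMr //; exact: truncn_itv.
have kd0 : 0 <= k%:R * d by rewrite mulr_ge0 // ltW.
have := kn (Ordinal kK) => /= h1.
have h2 := le_prim (pg n) (fing n) _ _ kd0 kt.
have tkd : `|t - k%:R * d| <= d.
  rewrite ger0_norm ?subr_ge0 // lerBlDr.
  by move: tk; rewrite -natr1 mulrDl mul1r addrC => /ltW.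
have := le_trans (ler_norm _) (dP t (k%:R * d) tkd).
move: h1 h2; move: (prim f t) (prim f _) (prim (g n) t) (prim (g n) _) => A B C D; lra.
Qed.

End Convergence.

End Space.

(** * Convergence in measure *)

Lemma vanishing_rearr {R : realType} {a : \bar R} {f : R -> \bar R} :
  a = 1%E \/ a = +oo%E -> L0 a f -> rearr_oo a f = 0%E ->
  vanishing (rearr a f).
Proof.
move=> ha mf; have a0 : (0 <= a)%E by case: ha => ->; rewrite ?lee01.
have pf := rearr_profile f mf a0.
case: ha => aE.
  move=> _ e e0; exists 1 => //.
  have -> : rearr a f 1 = 0%E by apply: (profile_out _ _ pf) => //; rewrite aE.
  by rewrite lee_fin ltW.
rewrite /rearr_oo aE eqxx -aE => lim0 e e0.
have ninc : nonincreasing_fun (rearr a f).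
  move=> s t st; apply: ereal_inf_le_tmp => _ [l [l0 lt] <-]; exists l => //.
  by split=> //; apply: le_trans lt _; rewrite lee_fin.
have := cvg_lim _ (nonincreasing_cvge ninc).
rewrite lim0 => /(_ (@ereal_hausdorff _)) inf0.
have : (ereal_inf (range (rearr a f)) < e%:E)%E by rewrite -inf0 lte_fin.
move=> /ereal_inf_lt [_ [t _ <-] te]; exists (Num.max t 0).
  by rewrite le_max lexx orbT.
by apply: le_trans (ltW te); apply: ninc; rewrite le_max lexx.
Qed.

(** An eventually small derivative makes [prim f t / t] small. For [a = 1] the choice [T = 1] leaves
    no [t] to check. *)
Lemma prim_sublinear {R : realType} {a : \bar R} {f : R -> \bar R} (e : R) :
  a = 1%E \/ a = +oo%E -> profile a f ->
  (forall q : R, 0 <= q -> (itg f 0 q < +oo)%E) -> vanishing f -> 0 < e ->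
  exists T, [/\ 0 <= T, (T%:E <= a)%E &
    forall t, (t%:E < a)%E -> T <= t -> prim f t <= e * t].
Proof.
move=> ha pf fin vf e0; case: ha => aE.
  exists 1; rewrite aE; split=> // t.
  by rewrite lte_fin ltNge => /negbTE ->.
have e20 : 0 < e / 2 by lra.
have [T0 T00 fT0] := vf _ e20.
have T1 : 0 < T0 + 1 by lra.
have P0 : 0 <= prim f (T0 + 1) by apply: (prim_ge0 pf fin); exact: ltW.
have D0 : 0 <= 2 * prim f (T0 + 1) / e by rewrite divr_ge0 ?mulr_ge0 // ltW.
exists (T0 + 1 + 2 * prim f (T0 + 1) / e); split; [lra|by rewrite aE leey|].
move=> t _ Tt; have t0 : 0 <= t by lra.
have sg := prim_supergradient pf fin (T0 + 1) t T1 t0.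
have v : fval f (T0 + 1) <= e / 2.
  rewrite -lee_fin (fvalE pf fin) //; apply: le_trans fT0.
  by apply: profile_nonincr pf T00 _; lra.
have : (t - (T0 + 1)) * fval f (T0 + 1) <= (t - (T0 + 1)) * (e / 2).
  by rewrite ler_wpM2l //; lra.
have : prim f (T0 + 1) * 2 <= (t - (T0 + 1)) * e.
  by rewrite -ler_pdivrMr // mulrC; lra.
move: sg; move: (prim f t) (prim f (T0 + 1)) (fval f (T0 + 1)) => A B C; nra.
Qed.

(** * Measure of the set where two rearrangements differ *)

Section LevelSets.
Context {R : realType} {a : \bar R} {f g : R -> \bar R}.
Hypotheses (pf : profile a f) (pg : profile a g).
Hypothesis finf : forall q : R, 0 <= q -> (itg f 0 q < +oo)%E.
Hypothesis fing : forall q : R, 0 <= q -> (itg g 0 q < +oo)%E.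

(* Between two points [s < t] of the set, [g - f >= e] throughout, since [f] and
   [g] are nonincreasing; hence [e (t - s)] is at most the increment of
   [prim g - prim f]. *)
Lemma leb_level_set (d T e k c : R) : 0 < d -> 0 < e -> 0 <= k -> 0 <= c ->
  (forall s t, 0 <= s -> s <= t -> t <= T ->
    (prim g t - prim g s) - (prim f t - prim f s) <= k) ->
  (leb R [set t | [/\ (d <= t)%R, (t <= T)%R, (fval f t < c)%R & (c + e < fval g t)%R]]
    <= (k / e)%:E)%E.
Proof.
move=> d0 e0 k0 c0 fg; set C := [set t | _].
have ke : 0 <= k / e by rewrite divr_ge0 // ltW.
have [[t0 Ct0]|C0] := pselect (C !=set0); last first.
  have -> : C = set0 by apply/seteqP; split=> // t Ct; apply: C0; exists t.
  by rewrite measure0 lee_fin.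
have Cdiam s t : C s -> C t -> s <= t -> t <= s + k / e.
  move=> [ds sT fs gs] [dt tT ft gt] st.
  have s0 : 0 < s by lra.
  have t0' : 0 < t by lra.
  have h1 := prim_supergradient pf finf s t s0 (ltW t0').
  have h2 := prim_supergradient pg fing t s t0' (ltW s0).
  have h3 := fg s t (ltW s0) st tT.
  have ts0 : 0 <= t - s by lra.
  have h4 := ler_wpM2l ts0 (ltW fs).
  have h5 := ler_wpM2l ts0 (ltW gt).
  rewrite -lerBlDl ler_pdivlMr //.
  move: h1 h2 h3 h4 h5.
  move: (prim f s) (prim f t) (prim g s) (prim g t) (fval f s) (fval g t).
  move=> x1 x2 x3 x4 x5 x6; nra.
have infC t : C t -> inf C <= t.
  by move=> Ct; apply: ge_inf => //; exists d => s [].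
have Csub : C `<=` `[inf C, inf C + k / e].
  move=> t Ct; rewrite /= in_itv /= infC //= -lerBlDr.
  apply: lb_le_inf; first by exists t0.
  move=> s Cs; rewrite lerBlDr; have [st|ts] := leP s t; first exact: Cdiam.
  by lra.
apply: le_trans (le_leb _ _ Csub) _.
by rewrite leb_itv_cc ?lerDl // addrAC subrr add0r.
Qed.

(** A gap above [2 * e] contains a full cell from [j * e] to [j * e + e], so the set splits into
    those of [leb_level_set]; the bound on [g] at [d] forces [j < K]. *)
Lemma leb_gap (d T e k : R) (K : nat) : 0 < d -> 0 < e -> 0 <= k ->
  (forall s t, 0 <= s -> s <= t -> t <= T ->
    (prim g t - prim g s) - (prim f t - prim f s) <= k) ->
  fval g d <= K%:R * e ->
  (leb R [set t | [/\ (d <= t)%R, (t <= T)%R & (fval f t + 2 * e < fval g t)%R]]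
    <= (K%:R * (k / e))%:E)%E.
Proof.
move=> d0 e0 k0 fg gK.
pose C (j : nat) := [set t | [/\ (d <= t)%R, (t <= T)%R, (fval f t < j%:R * e)%R &
  (j%:R * e + e < fval g t)%R]].
have sub : [set t | [/\ (d <= t)%R, (t <= T)%R & (fval f t + 2 * e < fval g t)%R]] `<=`
    [set t | exists2 j : nat, (j < K)%N & C j t].
  move=> t [dt tT fgt]; have t0 : 0 < t by lra.
  have fe0 : 0 <= fval f t / e by rewrite divr_ge0 ?(ltW e0) // (fval_ge0 pf) // ltW.
  have /andP[] := truncn_itv fe0; set j := Num.truncn _.
  rewrite ler_pdivlMr // ltr_pdivrMr // => h1 h2.
  have je : j.+1%:R * e = j%:R * e + e by rewrite -natr1 mulrDl mul1r.
  exists j.+1; last first.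
    by split=> //; rewrite je; lra.
  have gt : fval g t <= K%:R * e.
    by apply: le_trans gK; exact: (fval_nonincr pg fing).
  have : j.+1%:R * e < K%:R * e by rewrite je; lra.
  by rewrite ltr_pM2r // ltr_nat.
apply: le_trans (le_leb _ _ sub) _.
elim: K {gK sub} => [|K IH].
  rewrite (_ : [set t | _] = set0); first by rewrite measure0 mul0r.
  by apply/seteqP; split=> // t [].
have sub : [set t | exists2 j : nat, (j < K.+1)%N & C j t] `<=`
    [set t | exists2 j : nat, (j < K)%N & C j t] `|` C K.
  move=> t [j]; rewrite ltnS leq_eqVlt => /predU1P[->|jK] Cj; first by right.
  by left; exists j.
apply: le_trans (le_leb _ _ sub) _; apply: le_trans (lebU _ _) _.
rewrite -natr1 mulrDl mul1r EFinD; apply: leeD => //.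
by apply: leb_level_set => //; rewrite mulr_ge0 // ltW.
Qed.

End LevelSets.

Lemma cvg_in_measure_le (R : realType) (a : \bar R) (u_ : nat -> R -> \bar R)
    (u : R -> \bar R) :
  (forall e r : R, 0 < e -> 0 < r -> \forall n \near \oo,
    (leb R [set t | dom a t /\ (e%:E < `|u_ n t - u t|)%E] <= r%:E)%E) ->
  cvg_in_measure a u_ u.
Proof.
move=> H e e0; apply/fine_cvgP; split.
  have := H e 1 e0 ltr01; apply: filterS => n h.
  rewrite ge0_fin_numE; last by rewrite leb_ext; exact: outer_measure_ge0.
  by apply: le_lt_trans h _; exact: ltry.
apply/cvgr0Pnorm_le => r r0; have := H e r e0 r0; apply: filterS => n h.
have m0 : (0 <= leb R [set t | dom a t /\ (e%:E < `|u_ n t - u t|)%E])%E.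
  by rewrite leb_ext; exact: outer_measure_ge0.
rewrite /= ger0_norm ?fine_ge0 // -lee_fin fineK // ge0_fin_numE //.
by apply: le_lt_trans h _; exact: ltry.
Qed.

Theorem theorem3p2 (R : realType) (a : \bar R) (ha : a = 1%E \/ a = +oo%E)
    (E : completeNormedModType R) (ev : E -> R -> \bar R)
    (hE : is_banach_function_space a ev)
    (hF : fatou_property a ev)
    (hS : symmetric_space a ev)
    (x : E) (hx : LKM_point a ev x) (hx0 : rearr_oo a (ev x) = 0%E)
    (x_ : nat -> E)
    (hprec : forall n, hlp a (ev (x_ n)) (ev x))
    (hnorm : `|x_ n| @[n --> \oo] --> `|x|) :
  cvg_in_measure a (fun n => maxfun a (ev (x_ n))) (maxfun a (ev x)) /\
  cvg_in_measure a (fun n => rearr a (ev (x_ n))) (rearr a (ev x)).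
Proof.
have a0 : (0 < a)%E by case: ha => ->; rewrite ?lte01 ?lt0y.
have mx : L0 a (ev x) by exact: bfs_L0.
have vx := vanishing_rearr ha mx hx0.
have px := rearr_ev_profile a0 hE.
have fin (y : E) (q : R) (q0 : 0 <= q) : (itg (rearr a (ev y)) 0 q < +oo)%E.
  apply: (itg_fin a0 hE hS _ `|y|) => //.
  exact/(norm_le_rearr a0 hE hS).
have unif := prim_near_uniform a0 hE hF hS x x_ hx vx hprec hnorm.
have le_prim_n := le_prim_hlp a0 hE hS x x_ hprec.
have tail e := prim_sublinear e ha (px x) (fin x) vx.
set f := rearr a (ev x) in unif le_prim_n tail *.
split; apply: cvg_in_measure_le => e r e0 r0.
  have [T [T0 Ta Ttail]] := tail e e0.
  (* For [r < t <= T] the maximal functions differ by at most [e * r / t < e], and past [T] both lie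
     in [[0, e]]. Only [[0, r]] is left. *)
  have k0 : 0 < e * r by rewrite mulr_gt0.
  have := unif T (e * r) T0 Ta k0; apply: filterS => n un.
  apply: (@le_trans _ _ (leb R `[0%R, r])); last first.
    by rewrite (leb_itv_cc 0 r (ltW r0)) subr0.
  apply: le_leb => t [[t0 ta]].
  rewrite !(maxfun_prim a0 hE hS) // -EFinB abse_EFin lte_fin -mulrBr.
  rewrite /= in_itv /= t0 /= => et; rewrite leNgt; apply/negP => rt.
  have {}t0 : 0 < t by lra.
  have gf := le_prim_n n t (ltW t0).
  have g0 := prim_ge0 (px (x_ n)) (fin (x_ n)) t (ltW t0).
  have hT := Ttail t ta; have hu := un t (ltW t0).
  move: gf g0 et hT hu; rewrite -/f.
  move: (prim f t) (prim _ t) => A B BA B0 et hT hu.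
  move: et; rewrite normrM ger0_norm ?invr_ge0 ?(ltW t0) // distrC ger0_norm ?subr_ge0 //.
  rewrite mulrC ltr_pdivlMr // ltNge => /negP; apply.
  have [Tt|tT] := leP T t; first by have := hT Tt; lra.
  by apply: le_trans (hu (ltW tT)) _; rewrite ler_pM2l // ltW.
have [T [T0 Ta Ttail]] := tail e e0.
(* A difference above [e = 3 * e'] exceeds the gap [2 * e'] of [leb_gap], and three exceptional sets
   of measure at most [d = r / 4] stay within [r]. *)
pose e' := e / 3; have e'0 : 0 < e' by rewrite divr_gt0.
pose d := r / 4; have d0 : 0 < d by rewrite divr_gt0.
have fd0 : 0 <= prim f d / d / e'.
  have f0 := prim_ge0 (px x) (fin x) d (ltW d0).
  exact: divr_ge0 (divr_ge0 f0 (ltW d0)) (ltW e'0).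
(* Both functions are at most [prim f d / d] at [d], hence at most [K * e']; [k] is then chosen so
   that [leb_gap] yields exactly [d]. *)
pose K := (Num.truncn (prim f d / d / e')).+1.
have fK : prim f d / d <= K%:R * e'.
  by rewrite -ler_pdivrMr //; have /andP[_ /ltW] := truncn_itv fd0.
pose k := e' * d / K%:R.
have K0 : 0 < K%:R :> R by rewrite ltr0n.
have k0 : 0 < k by rewrite divr_gt0 // mulr_gt0.
have Kk : K%:R * (k / e') = d by rewrite /k; field; rewrite !gt_eqF.
have := unif T k T0 Ta k0; apply: filterS => n un.
set g := rearr a (ev (x_ n)) in un *.
have pg : profile a g := px (x_ n).
have fing := fin (x_ n); rewrite -/g in fing.
have pf : profile a f := px x.
have finf := fin x; rewrite -/f in finf.
have gf t : 0 <= t -> prim g t <= prim f t := le_prim_n n t.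
clear le_prim_n; clearbody f g.
have val_d y : profile a y -> (forall q : R, 0 <= q -> (itg y 0 q < +oo)%E) ->
    prim y d <= prim f d -> fval y d <= K%:R * e'.
  move=> py finy yf; apply: le_trans fK; rewrite ler_pdivlMr // mulrC.
  by apply: le_trans (mul_fval_le_prim py finy d d0) yf.
have B1 : (leb R [set t | [/\ (d <= t)%R, (t <= T)%R &
    (fval f t + 2 * e' < fval g t)%R]] <= d%:E)%E.
  rewrite -[X in (_ <= X%:E)%E]Kk.
  apply: (leb_gap pf pg finf fing d T e' k K d0 e'0 (ltW k0)).
    (* The difference of increments is [prim f s - prim g s <= k] plus [prim g t - prim f t <= 0];
       for [B2] the points [s] and [t] exchange roles. *)
    move=> s t s0 st tT; have t0 := le_trans s0 st.
    have := un s s0 (le_trans st tT); have := gf t t0.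
    move: (prim f s) (prim f t) (prim g s) (prim g t) => x1 x2 x3 x4; lra.
  exact: val_d pg fing (gf d (ltW d0)).
have B2 : (leb R [set t | [/\ (d <= t)%R, (t <= T)%R &
    (fval g t + 2 * e' < fval f t)%R]] <= d%:E)%E.
  rewrite -[X in (_ <= X%:E)%E]Kk.
  apply: (leb_gap pg pf fing finf d T e' k K d0 e'0 (ltW k0)).
    move=> s t s0 st tT; have t0 := le_trans s0 st.
    have := un t t0 tT; have := gf s s0.
    move: (prim f s) (prim f t) (prim g s) (prim g t) => x1 x2 x3 x4; lra.
  exact: val_d pf finf (lexx _).
set B1s := [set t | _] in B1; set B2s := [set t | _] in B2.
apply: (@le_trans _ _ (leb R (`[0%R, d] `|` (B1s `|` B2s)))).
  apply: le_leb => t [[t0 ta] et]; have [td|dt] := leP t d.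
    by left; rewrite /= in_itv /= t0.
  right; have {}t0 : 0 < t by lra.
  move: et; rewrite -(fvalE pg fing) // -(fvalE pf finf) //.
  rewrite -EFinB abse_EFin lte_fin => et.
  have v0 := fval_ge0 pg t (ltW t0).
  have w0 := fval_ge0 pf t (ltW t0).
  (* Beyond [T] both values lie in [[0, e]], so they cannot differ by more than [e]. *)
  have tT : t <= T.
    rewrite leNgt; apply/negP => Tt; have h := Ttail t ta (ltW Tt).
    have small y : profile a y -> (forall q : R, 0 <= q -> (itg y 0 q < +oo)%E) ->
        prim y t <= prim f t -> fval y t <= e.
      move=> py finy yf; rewrite -(ler_pM2r t0) mulrC.
      by apply: le_trans (mul_fval_le_prim py finy t t0) _; exact: le_trans h.
    have ve := small g pg fing (gf t (ltW t0)); have we := small f pf finf (lexx _).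
    move: et; rewrite ltNge => /negP; apply; rewrite ler_norml.
    by move: v0 w0 ve we; move: (fval g t) (fval f t) => A B *; apply/andP; split; lra.
  move: et; rewrite lter_normr => /orP[] et; [left|right]; split=> //; try exact: ltW.
    by move: et; rewrite /e'; move: (fval g t) (fval f t) => A B; lra.
  by move: et; rewrite /e'; move: (fval g t) (fval f t) => A B; lra.
apply: le_trans (lebU _ _) _; rewrite (leb_itv_cc 0 d (ltW d0)) subr0.
apply: (@le_trans _ _ (d%:E + (d%:E + d%:E))%E).
  by apply: leeD => //; apply: le_trans (lebU _ _) _; exact: leeD.
by rewrite -!EFinD lee_fin /d; lra.
Qed.
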